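(* Let $k$ be a field of characteristic zero and let $I\subset R=k[x_0,\dots,x_n]$ be the ideal of at most $n+1$ general fat points in $\mathbb P^n$. Let $c$ be the codimension of $I$, let $e(R/I)$ be the multiplicity of $R/I$, and for $1\le i\le c$ let $m_i$ and $M_i$ be the minimum and maximum degree, respectively, of a syzygy at step $i$ in the minimal graded free resolution of $R/I$. Then \[ \frac{1}{c!}\prod_{i=1}^{c} m_i\;\le\; e(R/I)\;\le\;\frac{1}{c!}\prod_{i=1}^{c} M_i. \]
   Context: $R=k[x_0,\dots,x_n]$ is standard graded. A set of at most $n+1$ general fat points consists of $r+1\le n+1$ points $P_0,\dots,P_r\in\mathbb P^n$ in general position (linearly independent) with positive integer multiplicities $a_0\ge a_1\ge\cdots\ge a_r$. After a linear change of coordinates one takes $P_i=[0:\cdots:0:1:0:\cdots:0]$ with the $1$ in the position of $x_i$; letting $\mathfrak p_i=(x_0,\dots,x_{i-1},x_{i+1},\dots,x_n)$, the ideal of the set of fat points is $I=\mathfrak p_0^{a_0}\cap\cdots\cap\mathfrak p_r^{a_r}$. In terms of graded Betti numbers, $m_i=\min\{j : \operatorname{Tor}_i^R(k,R/I)_j\ne 0\}$ and $M_i=\max\{j : \operatorname{Tor}_i^R(k,R/I)_j\neq 0\}$. The multiplicity $e(R/I)$ is the Hilbert–Samuel multiplicity (degree) of the graded ring $R/I$. *)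

(* Defs.v *)
From mathcomp Require Import all_boot all_order all_algebra mpoly.

Set Implicit Arguments.
Unset Strict Implicit.
Unset Printing Implicit Defensive.

Import GRing.Theory.
Local Open Scope ring_scope.

(* Ideals are propositional predicates, compared extensionally. *)
Section Ideals.
Variable R : comNzRingType.
Implicit Types (I J P : R -> Prop).

Definition is_ideal I : Prop :=
  [/\ I 0, forall f g, I f -> I g -> I (f + g) & forall f g, I g -> I (f * g)].

Definition ideal_le I J : Prop := forall f, I f -> J f.

Definition ideal_gen (S : R -> Prop) : R -> Prop :=
  fun f => forall J, is_ideal J -> ideal_le S J -> J f.

Definition ideal_add I J : R -> Prop :=
  fun f => exists g h, [/\ I g, J h & f = g + h].

Definition ideal_mul I J : R -> Prop :=
  ideal_gen (fun f => exists g h, [/\ I g, J h & f = g * h]).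

Fixpoint ideal_pow I (a : nat) : R -> Prop :=
  if a is a'.+1 then ideal_mul I (ideal_pow I a') else fun _ => True.

Definition is_prime P : Prop :=
  [/\ is_ideal P, ~ P 1 & forall f g, P (f * g) -> P f \/ P g].

(* There is a chain Q_0 < Q_1 < ... < Q_h = P of prime ideals. *)
Definition prime_chain P (h : nat) : Prop :=
  exists Q : nat -> R -> Prop,
    [/\ forall i, (i <= h)%N -> is_prime (Q i),
        forall i, (i < h)%N -> ideal_le (Q i) (Q i.+1) /\ ~ ideal_le (Q i.+1) (Q i)
      & forall f, Q h f <-> P f].

Definition prime_height P (h : nat) : Prop :=
  prime_chain P h /\ forall h', prime_chain P h' -> (h' <= h)%N.

Definition codimension I (c : nat) : Prop :=
  (exists P, [/\ is_prime P, ideal_le I P & prime_height P c]) /\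
  (forall P h, is_prime P -> ideal_le I P -> prime_height P h -> (c <= h)%N).

End Ideals.

Section Polynomials.
Variables (k : fieldType) (n : nat).
Notation R := {mpoly k[n]}.
Implicit Types (I : R -> Prop).

Definition irrelevant : R -> Prop := ideal_gen (fun f => exists i, f = 'X_i).

(* The homogeneous ideal of the point of projective space with homogeneous
   coordinates v. *)
Definition point_ideal (v : 'rV[k]_n) : R -> Prop :=
  ideal_gen (fun f => (exists d : nat, f \is d.-homog) /\ f.@[fun j => v 0 j] = 0).

Definition fat_points_ideal r (P : 'M[k]_(r, n)) (a : 'I_r -> nat) : R -> Prop :=
  fun f => forall i, ideal_pow (point_ideal (row i P)) (a i) f.

(* dim_k (R / I) = h: there are h polynomials whose classes form a basis. *)
Definition quot_dim I (h : nat) : Prop :=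
  exists b : 'I_h -> R,
    (forall f, exists c : 'I_h -> k, I (f - \sum_i c i *: b i)) /\
    (forall c : 'I_h -> k, I (\sum_i c i *: b i) -> forall i, c i = 0).

(* Q is the Hilbert-Samuel polynomial of R / I, i.e. Q(t) is the length of
   R / (I + m^(t+1)) for t large, m being the irrelevant ideal.  Its degree is
   the dimension d of R / I, and the multiplicity is d! times its leading
   coefficient. *)
Definition hilbert_samuel_poly I (Q : {poly rat}) : Prop :=
  exists t0 : nat, forall t : nat, (t0 <= t)%N ->
    exists2 h : nat, quot_dim (ideal_add I (ideal_pow irrelevant t.+1)) h
                   & Q.[t%:R] = h%:R.

Definition multiplicity I (e : rat) : Prop :=
  exists2 Q : {poly rat}, hilbert_samuel_poly I Q
                        & e = ((size Q).-1)`!%:R * lead_coef Q.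

(* f is an element of degree d of R(-e). *)
Definition in_twist (e d : nat) (f : R) : Prop :=
  if (e <= d)%N then f \is (d - e).-homog else f == 0.

(* Minimal graded free resolutions of R / I.  The i-th module is
     F_i = R(-d_1) + ... + R(-d_b),  [:: d_1; ...; d_b] = syz_deg i;
   natural numbers suffice since R / I vanishes in negative degrees.
   Elements of F_i are row vectors, on which matrices act on the right;
   the augmentation F_0 -> R / I is the class modulo I of u |-> u *m res_aug.
   Minimality says that the image of F_(i+1) lies in m F_i. *)
Record min_graded_resolution I := MinGradedResolution {
  syz_deg : nat -> seq nat;
  res_aug : 'cV[R]_(size (syz_deg 0));
  res_diff : forall i, 'M[R]_(size (syz_deg i.+1), size (syz_deg i));
  res_aug_homog : forall q : 'I_(size (syz_deg 0)),
    res_aug q 0 \is (nth 0%N (syz_deg 0) q).-homog;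
  res_diff_homog : forall i (p : 'I_(size (syz_deg i.+1)))
                            (q : 'I_(size (syz_deg i))),
    in_twist (nth 0%N (syz_deg i) q) (nth 0%N (syz_deg i.+1) p) (res_diff i p q);
  res_aug_surj : forall f, exists u : 'rV_(size (syz_deg 0)),
    I (f - (u *m res_aug) 0 0);
  res_exact0 : forall u : 'rV_(size (syz_deg 0)),
    I ((u *m res_aug) 0 0) <-> exists v, u = v *m res_diff 0;
  res_exact : forall i (u : 'rV_(size (syz_deg i.+1))),
    u *m res_diff i = 0 <-> exists v, u = v *m res_diff i.+1;
  res_minimal : forall i p q, irrelevant (res_diff i p q)
}.

(* Both values are 0 if the i-th module of the resolution is 0. *)
Definition min_syz_deg I (F : min_graded_resolution I) (i : nat) : nat :=
  foldr minn (head 0%N (syz_deg F i)) (syz_deg F i).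

Definition max_syz_deg I (F : min_graded_resolution I) (i : nat) : nat :=
  (\max_(d <- syz_deg F i) d)%N.

End Polynomials.

(* Main.v *)
From HB Require Import structures.
From Stdlib Require Import Classical_Prop Classical_Pred_Type.
Require Import Defs.
From mathcomp Require Import all_boot all_order all_algebra mpoly zify ring.

Set Implicit Arguments.
Unset Strict Implicit.
Unset Printing Implicit Defensive.

Import GRing.Theory Num.Theory.
Local Open Scope ring_scope.

(** Linear forms can be chosen so that the points are coordinate points
([row_free_completion]); giving multiplicity 0 to the missing ones, the ideal I is spanned by
the monomials X^m with m_l + a_l <= deg m for every l ([fat_points_linsub]). Its codimension is
n ([fat_codim]). In large degree a monomial outside I violates exactly one of these conditions,
so that e(R/I) is the sum of the C(a_l + n - 1, n) ([fat_multiplicity]); in every degree this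
sum is at least the Hilbert function of R/I ([count_standard_le]).

It remains to bound m_i from above and M_i from below, which means exhibiting syzygies of
explicit degrees. Koszul homology also computes Tor(k, R/I): following the connecting maps of
the short exact sequences of syzygy modules, a Koszul cycle of R/I which is not a boundary
forces a syzygy of the same degree in any minimal resolution ([koszul_cycle_bounds]). The
exactness of the Koszul complex of R that this needs comes from Euler's formula in
characteristic zero ([kdiff_kextd]). For I, this gives the criterion [fat_syzygy]: a monomial
M in I for which two of the conditions are equalities, one of them at a variable that divides
M, yields a syzygy of degree deg M + i - 1 at step i as soon as i - 1 conditions are strict.

Upper bound. The generator X_0^(a_1) X_1^(a_0) shows M_i >= a_0 + a_1 + i - 1
([large_syzygy]), and n! e is at most the product of these n integers, because
the sum of the C(a_l + n - 1, n) is at most C(a_0 + a_1 + n - 1, n) ([point_mult_add]).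

Lower bound. Let alpha be the initial degree of I. Suitable monomials of degree alpha and
alpha + 1 show m_i <= alpha + i - 1 for i <= q and m_i <= alpha + i for q < i <= n, for some q
such that dim I_alpha <= C(alpha + q - 1, q - 1) ([small_syzygies]). Since e is at least the
Hilbert function in degree alpha, it is at least C(alpha + n, n) - C(alpha + q - 1, q - 1), and
n! times this difference is at least the product of the bounds on the m_i
([prod_two_strands]). *)

(** * The Koszul complex of the variables *)

Section Koszul.
Variables (k : fieldType) (N : nat).
Notation R := {mpoly k[N]}.
Implicit Types (s : {set 'I_N}).

(** The sign of e_s in the boundary of e_(l |: s), as a polynomial so that it can multiply
variables. *)
Definition ksgn (l : 'I_N) s : R := (-1) ^+ #|[set t in s | (t < l)%N]|.

Lemma ksgnE l s : ksgn l s = ((-1) ^+ #|[set t in s | (t < l)%N]| : k)%:MP.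
Proof. by rewrite /ksgn rmorphXn /= mpolyCN mpolyC1. Qed.

Lemma ksgnU l l' s : l' \notin s ->
  ksgn l (l' |: s) = (-1) ^+ (l' < l)%N * ksgn l s.
Proof.
move=> l's; rewrite /ksgn -exprD; congr (_ ^+ _).
case: (boolP (l' < l)%N) => h.
  have -> : [set t in l' |: s | (t < l)%N] = l' |: [set t in s | (t < l)%N].
    apply/setP=> t; rewrite !inE; case: eqP => [->|] //=; by rewrite h.
  by rewrite cardsU1 inE (negPf l's).
rewrite add0n; apply: eq_card => t; rewrite !inE.
by case: eqP => [->|] //=; rewrite (negPf h) andbF.
Qed.

Lemma ksgn_sq l s : ksgn l s * ksgn l s = 1.
Proof. by rewrite /ksgn -expr2 sqrr_sign. Qed.

Lemma ksgn_swap l l' s : l != l' -> l \notin s -> l' \notin s ->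
  ksgn l s * ksgn l' (l |: s) = - (ksgn l' s * ksgn l (l' |: s)).
Proof.
move=> ne ls l's; rewrite !ksgnU //.
case: ltngtP => [_|_|/val_inj e]; last by rewrite e eqxx in ne.
  by rewrite expr0 expr1 mul1r mulN1r mulrN mulrC.
by rewrite expr0 expr1 mul1r mulN1r mulrN opprK mulrC.
Qed.

Section Module.
Variable M : lmodType R.

(** The Koszul differential of the variables with coefficients in [M]; a chain is the family
of its coefficients on the basis e_s of the exterior algebra, all degrees together. *)
Definition kdiff (w : {set 'I_N} -> M) s : M :=
  \sum_(l | l \notin s) (ksgn l s * 'X_l) *: w (l |: s).

Lemma eq_kdiff w w' : w =1 w' -> kdiff w =1 kdiff w'.
Proof. by move=> e s; apply: eq_bigr => l _; rewrite e. Qed.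

Lemma kdiffB w w' s : kdiff (fun t => w t - w' t) s = kdiff w s - kdiff w' s.
Proof. by rewrite -sumrB; apply: eq_bigr => l _; rewrite scalerBr. Qed.

Lemma kdiff_kdiff w s : kdiff (kdiff w) s = 0.
Proof.
pose G (l l' : 'I_N) := (ksgn l s * 'X_l * (ksgn l' (l |: s) * 'X_l')) *: w (l' |: (l |: s)).
have -> : kdiff (kdiff w) s
    = \sum_(l | l \notin s) \sum_(l' | (l' \notin s) && (l' != l)) G l l'.
  apply: eq_bigr => l ls; rewrite scaler_sumr.
  apply: eq_big => [l'|l' _]; first by rewrite !inE negb_or andbC.
  by rewrite scalerA.
have Gswap l l' : l \notin s -> l' \notin s -> l != l' -> G l l' = - G l' l.
  move=> ls l's ne; rewrite /G setUCA -scaleNr; congr (_ *: _).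
  by rewrite mulrACA (ksgn_swap ne ls l's) mulNr ['X_l * _]mulrC [in RHS]mulrACA.
(* swapping the two removed indices changes the sign, so pairs with l' < l cancel those
   with l < l' *)
have -> : \sum_(l | l \notin s) \sum_(l' | (l' \notin s) && (l' != l)) G l l'
  = \sum_(l | l \notin s) \sum_(l' | (l' \notin s) && (l' < l)%N) G l l'
  + \sum_(l | l \notin s) \sum_(l' | (l' \notin s) && (l < l')%N) G l l'.
  rewrite -big_split; apply: eq_bigr => l ls /=.
  rewrite (bigID (fun l' : 'I_N => (l' < l)%N)) /=; congr (_ + _); apply: eq_bigl => l';
    rewrite -andbA; congr (_ && _); rewrite -val_eqE /=; case: ltngtP => //.
rewrite [X in _ + X](exchange_big_dep (fun l' => l' \notin s)) /=; last by move=> i j _ /andP[].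
rewrite -big_split big1 //= => l ls.
rewrite [X in _ + X](eq_bigl (fun l' => (l' \notin s) && (l' < l)%N)); last first.
  by move=> l'; rewrite ls.
rewrite -big_split big1 //= => l' /andP[l's lt].
by rewrite Gswap ?addNr // -val_eqE neq_ltn lt orbT.
Qed.

End Module.

Lemma kdiff_linear (M M' : lmodType R) (f : M -> M') (w : {set 'I_N} -> M) s :
  (forall a x y, f (a *: x + y) = a *: f x + f y) -> f (kdiff w s) = kdiff (f \o w) s.
Proof.
move=> fl; have f0 : f 0 = 0 by move: (fl (-1) 0 0); rewrite scaler0 add0r scaleN1r addNr.
have fD x y : f (x + y) = f x + f y by rewrite -[x]scale1r fl !scale1r.
rewrite /kdiff (big_morph f fD f0); apply: eq_bigr => l _.
by rewrite -[_ *: w _]addr0 fl f0 addr0.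
Qed.

(** The exterior derivative, when [w s] is read as the coefficient of the form dx_s. *)
Definition kextd (w : {set 'I_N} -> R) s : R :=
  \sum_(l | l \in s) ksgn l (s :\ l) * (w (s :\ l))^`M(l).

Lemma mderiv_ksgn l j s (f : R) :
  (ksgn l s * f)^`M(j) = ksgn l s * f^`M(j).
Proof. by rewrite ksgnE mderiv_mulC. Qed.

Lemma mderivXU (i j : 'I_N) : ('X_i : R)^`M(j) = (i == j)%:R.
Proof.
rewrite mderivX mnm1E; case: eqP => [->|_]; last by rewrite scale0r.
rewrite scale1r -mpolyX0; congr 'X_[_]; apply/mnmP => t.
by rewrite mnmBE subnn mnm0E.
Qed.

Lemma mderiv_ksgnX l i j s (f : R) :
  (ksgn l s * 'X_i * f)^`M(j) = ksgn l s * ((i == j)%:R * f + 'X_i * f^`M(j)).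
Proof. by rewrite -mulrA mderiv_ksgn mderivM mderivXU. Qed.

Lemma sum2_cancel (V : zmodType) (I : finType) (A B : pred I) (F G : I -> I -> V) :
  (forall i j, A i -> B j -> F i j + G j i = 0) ->
  \sum_(i | A i) \sum_(j | B j) F i j + \sum_(j | B j) \sum_(i | A i) G j i = 0.
Proof.
move=> FG; rewrite exchange_big -big_split big1 //= => j Bj.
by rewrite -big_split big1 //= => i Ai; apply: FG.
Qed.

(** Cartan's formula: the Koszul differential is the contraction by the Euler vector field, so
its anticommutator with the exterior derivative is the Lie derivative along that field, which
multiplies a homogeneous form by its total degree. *)
Lemma kdiff_kextd (w : {set 'I_N} -> R) s :
  (@kdiff R^o (kextd w) s : R) + kextd (@kdiff R^o w) s
  = \sum_l 'X_l * (w s)^`M(l) + (w s) *+ #|s|.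
Proof.
have e1 : (@kdiff R^o (kextd w) s : R) = \sum_(l | l \notin s) 'X_l * (w s)^`M(l)
   + \sum_(l | l \notin s) \sum_(j | j \in s)
       (ksgn l s * ksgn j (l |: (s :\ j))) * ('X_l * (w (l |: (s :\ j)))^`M(j)).
  rewrite -big_split; apply: eq_bigr => l ls; rewrite /kextd /=.
  rewrite /GRing.scale /= mulr_sumr (bigD1 l) ?setU11 //= setU1K //.
  congr (_ + _).
    by rewrite mulrACA ksgn_sq mul1r.
  apply: eq_big => [j|j /andP[]]; rewrite !inE.
    by case: eqP => [->|] //=; rewrite ?(negPf ls) ?andbT.
  move=> _ ne; have -> : (l |: s) :\ j = l |: s :\ j.
    by apply/setP=> x; rewrite !inE; case: eqP => [->|] //=; rewrite ?(negPf ne) ?andbF.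
  by rewrite mulrACA.
have e2 : kextd (@kdiff R^o w) s = \sum_(l | l \in s) ('X_l * (w s)^`M(l) + w s)
   + \sum_(j | j \in s) \sum_(l | l \notin s)
       (ksgn j (s :\ j) * ksgn l (s :\ j)) * ('X_l * (w (l |: (s :\ j)))^`M(j)).
  rewrite -big_split; apply: eq_bigr => j js; rewrite /kdiff /= raddf_sum /=.
  rewrite mulr_sumr (bigD1 j) ?setD11 //= setD1K //.
  congr (_ + _).
    by rewrite /GRing.scale /= mderiv_ksgnX mulrA ksgn_sq !mul1r eqxx mul1r addrC.
  apply: eq_big => [l|l /andP[_ ne]].
    by rewrite !inE negb_and negbK; case: eqP => [->|] //=; rewrite ?js ?andbT.
  by rewrite /GRing.scale /= mderiv_ksgnX (negPf ne) mul0r add0r mulrA.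
rewrite e1 e2 addrACA sum2_cancel ?addr0; last first.
  move=> l j ls js; rewrite -mulrDl.
  have ne : l != j by apply: contraNneq ls => ->.
  have jn : j \notin s :\ j by rewrite setD11.
  have ln : l \notin s :\ j by rewrite !inE (negPf ls) andbF.
  have -> : ksgn l s = (-1) ^+ (j < l)%N * ksgn l (s :\ j).
    by rewrite -ksgnU // setD1K.
  rewrite ksgnU // mulrACA -exprD.
  suff -> : (-1) ^+ ((j < l)%N + (l < j)%N) = -1 :> R.
    by rewrite mulN1r [ksgn j _ * _]mulrC addNr mul0r.
  by case: ltngtP => //= /val_inj e; move: ne; rewrite e eqxx.
rewrite addrC big_split /= sumr_const -addrA [_ *+ _ + _]addrC addrA; congr (_ + _).
by rewrite [RHS](bigID (fun l => l \in s)).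
Qed.

Lemma euler_homog (f : R) d : f \is d.-homog -> \sum_l 'X_l * f^`M(l) = d%:R * f.
Proof.
move=> /dhomogP hf; rewrite [f]mpolyE.
under eq_bigr => l _ do rewrite raddf_sum /= mulr_sumr.
rewrite exchange_big /= mulr_sumr; apply: eq_big_seq => m /hf /= <-.
rewrite mdegE natr_sum mulr_suml; apply: eq_bigr => l _.
rewrite mderivZ mderivX -!scalerAr -mpolyXD mulr_natl scaler_nat.
case: (posnP (m l)) => [->|ml]; first by rewrite !mulr0n.
by rewrite addmC submK // lep1mP -lt0n.
Qed.

End Koszul.

(** * Exactness in characteristic zero *)

Section Exactness.
Variables (k : fieldType) (N : nat).
Hypothesis char_k : [pchar k] =i pred0.
Notation R := {mpoly k[N]}.
Implicit Types (s t : {set 'I_N}).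

Lemma natr_char0_neq0 n : (0 < n)%N -> n%:R != 0 :> k.
Proof. by move=> n0; rewrite ((pcharf0P k).1 char_k) -lt0n. Qed.

Lemma kdiff_scale (c : k) (w : {set 'I_N} -> R) s :
  @kdiff _ _ R^o (fun t => c *: w t) s = c *: (@kdiff _ _ R^o w s : R).
Proof.
rewrite scaler_sumr; apply: eq_bigr => l _.
by rewrite /GRing.scale /= -scalerAr.
Qed.

(** In characteristic 0 and positive total degree [d - e], the exterior derivative divided by
this degree is a contracting homotopy of the Koszul complex. *)
Lemma kdiff_exact_scalar (w : {set 'I_N} -> R) e d :
    (forall s, in_twist (e + #|s|) d (w s)) -> (forall s, w s != 0 -> (e < d)%N) ->
    (forall s, @kdiff _ _ R^o w s = 0) ->
  forall s, w s = @kdiff _ _ R^o (fun t => ((d - e)%:R^-1 : k) *: kextd w t) s.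
Proof.
move=> hw he kw s; rewrite kdiff_scale.
have eqE : (@kdiff _ _ R^o (kextd w) s : R) = ((d - e)%:R : k) *: w s.
  have := kdiff_kextd w s.
  have -> : kextd (@kdiff _ _ R^o w) s = 0.
    by rewrite /kextd big1 // => l _; rewrite kw linear0 mulr0.
  rewrite addr0 => ->; have := hw s; rewrite /in_twist; case: ifP => [le hs|_ /eqP ->].
    rewrite (euler_homog hs) mulr_natl -mulrnDr scaler_nat; congr (_ *+ _).
    by rewrite subnDA subnK // leq_subRL // (leq_trans _ le) // leq_addr.
  by rewrite mul0rn addr0 scaler0 big1 // => l _; rewrite linear0 mulr0.
rewrite eqE scalerA; have [->|ws] := eqVneq (w s) 0; first by rewrite scaler0.
by rewrite mulVf ?scale1r // natr_char0_neq0 // subn_gt0 (he _ ws).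
Qed.

Lemma kdiff_exact b (e : 'I_b -> nat) (w : {set 'I_N} -> 'rV[R]_b) d j :
    (forall s p, in_twist (e p + #|s|) d (w s 0 p)) ->
    (forall s p, w s 0 p != 0 -> (e p < d)%N) ->
    (forall s, kdiff w s = 0) -> (forall s, w s != 0 -> #|s| = j) ->
  exists v : {set 'I_N} -> 'rV[R]_b,
    (forall s, w s = kdiff v s) /\ (forall s, v s != 0 -> #|s| = j.+1).
Proof.
move=> hw he kw suppw.
exists (fun s => \row_p (((d - e p)%:R^-1 : k) *: kextd (fun t => w t 0 p) s)).
split=> s.
  apply/rowP => p.
  rewrite (@kdiff_linear _ _ _ R^o (fun u : 'rV[R]_b => u 0 p)); last by move=> a x y; rewrite !mxE.
  rewrite [LHS](@kdiff_exact_scalar (fun t => w t 0 p) (e p) d) //.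
  - by apply: (@eq_kdiff _ _ R^o) => t; rewrite /= mxE.
  - by move=> t; apply: he.
  - move=> t; transitivity ((kdiff w t) 0 p); last by rewrite kw mxE.
    by rewrite (@kdiff_linear _ _ _ R^o (fun u : 'rV[R]_b => u 0 p)) // => a x y; rewrite !mxE.
apply: contraNeq => /eqP cs; apply/eqP/rowP => p; rewrite !mxE /kextd big1 ?scaler0 // => l ls.
suff -> : w (s :\ l) = 0 by rewrite mxE linear0 mulr0.
apply/eqP/negPn/negP => /suppw E; apply: cs.
by rewrite (cardsD1 l) ls E.
Qed.

(** The component of degree [d] when [f] is viewed in R(-e). *)
Definition twist_comp e d (f : R) : R :=
  if (e <= d)%N then pihomog mdeg (d - e) f else 0.

Lemma in_twist_comp e d f : in_twist e d (twist_comp e d f).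
Proof. by rewrite /in_twist /twist_comp; case: leqP => _ //; apply: pihomogP. Qed.

Lemma twist_comp_id e d f : in_twist e d f -> twist_comp e d f = f.
Proof.
by rewrite /in_twist /twist_comp; case: leqP => [_ h|_ /eqP //]; apply: pihomog_dE.
Qed.

Lemma twist_compB e d f g : twist_comp e d (f - g) = twist_comp e d f - twist_comp e d g.
Proof. by rewrite /twist_comp; case: ifP; rewrite ?raddfB ?subr0. Qed.

Lemma twist_comp0 e d : twist_comp e d 0 = 0.
Proof. by rewrite /twist_comp raddf0 if_same. Qed.

Lemma twist_comp_sum e d (I : Type) (r : seq I) (P : pred I) (G : I -> R) :
  twist_comp e d (\sum_(i <- r | P i) G i) = \sum_(i <- r | P i) twist_comp e d (G i).
Proof. by rewrite /twist_comp; case: ifP; rewrite ?raddf_sum // big1. Qed.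

Lemma pihomogMr c m (g a : R) : a \is c.-homog ->
  pihomog mdeg m (g * a) = if (c <= m)%N then pihomog mdeg (m - c) g * a else 0.
Proof.
move=> ha; set K := maxn (msize g) m.+1.
rewrite [in LHS](@pihomog_partitionE _ _ mdeg K g) ?leq_maxl // mulr_suml raddf_sum /=.
have E (i : 'I_K) : pihomog mdeg m (pihomog mdeg i g * a)
    = if (i + c == m)%N then pihomog mdeg i g * a else 0.
  have h : pihomog mdeg i g * a \is (i + c).-homog by apply: dhomogM => //; apply: pihomogP.
  case: eqP => [<-|/eqP ne]; first exact: pihomog_dE.
  by apply: pihomog_ne0 h.
rewrite (eq_bigr _ (fun i _ => E i)); case: leqP => cm.
  have lt : (m - c < K)%N by rewrite (leq_ltn_trans (leq_subr _ _)) // leq_max ltnSn orbT.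
  rewrite (bigD1 (Ordinal lt)) //= subnK // eqxx big1 ?addr0 // => i.
  by rewrite -val_eqE /= => ne; case: eqP => // ei; rewrite -ei addnK eqxx in ne.
by rewrite big1 // => i _; case: eqP => // e; rewrite -e ltnNge leq_addl in cm.
Qed.

Lemma twist_compMr e e' d g a : in_twist e e' a ->
  twist_comp e d (g * a) = twist_comp e' d g * a.
Proof.
rewrite /in_twist; case: leqP => [le ha|_ /eqP ->]; last by rewrite !mulr0 twist_comp0.
rewrite /twist_comp; case: leqP => ed; last by rewrite leqNgt (leq_trans ed le) mul0r.
rewrite (pihomogMr _ _ ha) leq_sub2rE //; case: ifP; rewrite ?mul0r // => _.
by rewrite subnBA // subnK.
Qed.

Lemma in_twistD c e d (f : R) : in_twist (e + c) (d + c) f = in_twist e d f.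
Proof. by rewrite /in_twist leq_add2r subnDr. Qed.

(** The component of degree [d] of an element of the direct sum of the R(-e_p). *)
Definition row_comp b (e : 'I_b -> nat) d (u : 'rV[R]_b) : 'rV[R]_b :=
  \row_p twist_comp (e p) d (u 0 p).

Lemma row_compB b (e : 'I_b -> nat) d u v :
  row_comp e d (u - v) = row_comp e d u - row_comp e d v.
Proof. by apply/rowP => p; rewrite !mxE twist_compB. Qed.

Lemma row_comp0 b (e : 'I_b -> nat) d : row_comp e d 0 = 0.
Proof. by apply/rowP => p; rewrite !mxE twist_comp0. Qed.

Lemma row_comp_id b (e : 'I_b -> nat) d u : row_comp e d (row_comp e d u) = row_comp e d u.
Proof. by apply/rowP => p; rewrite !mxE twist_comp_id //; apply: in_twist_comp. Qed.

Lemma row_compM b b' (e : 'I_b -> nat) (e' : 'I_b' -> nat) d u (A : 'M[R]_(b, b')) :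
  (forall p q, in_twist (e' q) (e p) (A p q)) ->
  row_comp e' d (u *m A) = row_comp e d u *m A.
Proof.
move=> hA; apply/rowP => q; rewrite !mxE twist_comp_sum; apply: eq_bigr => p _.
by rewrite (twist_compMr _ _ (hA p q)) mxE.
Qed.

(** In a Koszul chain over that direct sum, e_s counts for degree [#|s|]. *)
Definition kcomp b (e : 'I_b -> nat) d (w : {set 'I_N} -> 'rV[R]_b) s :=
  row_comp (fun p => e p + #|s|)%N d (w s).

Lemma ksgn_homog l s : ksgn k l s \is 0.-homog.
Proof. by rewrite ksgnE -[_%:MP]mulr1 mul_mpolyC dhomogZ // dhomog1. Qed.

Lemma kcomp_kdiff b (e : 'I_b -> nat) d w s :
  kcomp e d (kdiff w) s = kdiff (kcomp e d w) s.
Proof.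
apply/rowP => p; rewrite !mxE !summxE twist_comp_sum; apply: eq_bigr => l ls.
rewrite !mxE mulrC [RHS]mulrC; apply: twist_compMr.
rewrite cardsU1 ls addnCA -[X in in_twist X]add0n in_twistD /in_twist.
by apply: (@dhomogM _ _ _ 0 _ 1); rewrite ?ksgn_homog // dhomogX /= mdeg1.
Qed.

End Exactness.

(** * Koszul homology and free resolutions *)

Lemma fin_skolem (T : finType) (U : Type) (Q : T -> U -> Prop) :
  (forall t, exists u, Q t u) -> exists f : T -> U, forall t, Q t (f t).
Proof. exact: (@fin_all_exists T (fun _ => U) Q). Qed.

Section Chase.
Variables (k : fieldType) (N : nat).
Hypothesis char_k : [pchar k] =i pred0.
Notation R := {mpoly k[N]}.
Implicit Types (s t : {set 'I_N}).
Variables (I : R -> Prop) (F : min_graded_resolution I).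
Hypothesis idI : is_ideal I.
Hypothesis homI : forall d f, I f -> I (pihomog mdeg d f).
Variable d : nat.

Notation rowF i := 'rV[R]_(size (syz_deg F i)).
Definition gen_deg i (p : 'I_(size (syz_deg F i))) := nth 0%N (syz_deg F i) p.
Arguments gen_deg i p : clear implicits.

(** The elements of the syzygy module Z_i, the image of F_(i+1) in F_i. *)
Definition boundary_in i (u : rowF i) := exists v, u = v *m res_diff F i.
Definition ksupp (V : zmodType) j (w : {set 'I_N} -> V) := forall t, w t != 0 -> #|t| = j.

(** The j-th Koszul homology of Z_i vanishes in degree [d]; cycles are not assumed
homogeneous, only their components of degree [d] must bound. *)
Definition syzygy_acyclic i j := forall z : {set 'I_N} -> rowF i,
  (forall t, boundary_in (z t)) -> ksupp j z -> (forall t, kdiff z t = 0) ->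
  exists y : {set 'I_N} -> rowF i,
    [/\ forall t, boundary_in (y t), ksupp j.+1 y
      & forall t, kcomp (gen_deg i) d z t = kdiff y t].

Lemma kdiff_mulmx a b (A : 'M[R]_(a, b)) (w : {set 'I_N} -> 'rV[R]_a) t :
  kdiff (fun s => w s *m A) t = kdiff w t *m A.
Proof.
by rewrite (@kdiff_linear _ _ _ _ (mulmx^~ A)) // => c x y; rewrite mulmxDl scalemxAl.
Qed.

Lemma kdiff_supp (M : lmodType R) j (w : {set 'I_N} -> M) :
  ksupp j w -> ksupp j.-1 (kdiff w).
Proof.
move=> hw t; apply: contraNeq => ct; rewrite /kdiff big1 // => l lt.
suff -> : w (l |: t) = 0 by rewrite scaler0.
apply/eqP/negPn/negP => /hw E; case/eqP: ct.
by rewrite -E cardsU1 lt.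
Qed.

Lemma kcomp_mulmx i (w : {set 'I_N} -> rowF i.+1) t :
  kcomp (gen_deg i) d (fun s => w s *m res_diff F i) t
  = kcomp (gen_deg i.+1) d w t *m res_diff F i.
Proof.
by apply: row_compM => p q; rewrite in_twistD; apply: res_diff_homog.
Qed.

Lemma kcomp_supp b (e : 'I_b -> nat) j (w : {set 'I_N} -> 'rV[R]_b) :
  ksupp j w -> ksupp j (kcomp e d w).
Proof.
by move=> hw t nz; apply: hw; apply: contraNneq nz => w0; rewrite /kcomp w0 row_comp0.
Qed.

Lemma lift_boundary i j (z : {set 'I_N} -> rowF i) :
  (forall t, boundary_in (z t)) -> ksupp j z ->
  exists w, (forall t, z t = w t *m res_diff F i) /\ ksupp j w.
Proof.
move=> hz sz.
have [t|w hw] := @fin_skolem _ _ (fun t v => z t = v *m res_diff F i /\ (v != 0 -> #|t| = j)).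
  have [z0|nz] := eqVneq (z t) 0; first by exists 0; rewrite mul0mx eqxx.
  by have [v ->] := hz t; exists v; split=> // _; apply: sz.
by exists w; split=> t; case: (hw t).
Qed.

(** Over a free module, the only classes are those of its generators, in Koszul degree 0:
they are excluded by either alternative of the first hypothesis. *)
Lemma kcomp_exact b (e : 'I_b -> nat) j (w : {set 'I_N} -> 'rV[R]_b) :
    (j > 0)%N \/ (forall p, e p != d) -> ksupp j w ->
    (forall t, kdiff (kcomp e d w) t = 0) ->
  exists v, (forall t, kcomp e d w t = kdiff v t) /\ ksupp j.+1 v.
Proof.
move=> hj sw kw; apply: (kdiff_exact char_k (e := e) (d := d)) kw _.
- by move=> t p; rewrite mxE; apply: in_twist_comp.
- move=> t p nz; have ct : #|t| = j.
    apply: (kcomp_supp (e := e) sw); apply: contraNneq nz => ->; by rewrite mxE.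
  move: nz; rewrite mxE /twist_comp ct; case: (leqP (e p + j)); last by rewrite eqxx.
  move=> le _; case: hj => [j0|/(_ p) ne].
    by apply: leq_trans le; rewrite -[X in (X < _)%N]addn0 ltn_add2l.
  by rewrite ltn_neqAle ne (leq_trans _ le) // leq_addr.
- exact: kcomp_supp.
Qed.

(** Without generators of degree [d], everything of degree [d] in F_(i+1) lies in the
irrelevant ideal times F_(i+1), hence also its image. *)
Lemma syzygy_acyclic_base i : d \notin syz_deg F i.+1 -> syzygy_acyclic i 0.
Proof.
move=> dF z hz sz _; have [w [zw sw]] := lift_boundary hz sz.
have [||v [wv sv]] := @kcomp_exact _ (gen_deg i.+1) 0 w _ sw.
- by right=> p; apply: contraNneq dF => <-; apply: mem_nth.
- move=> t; apply: big1 => l lt.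
  suff -> : kcomp (gen_deg i.+1) d w (l |: t) = 0 by rewrite scaler0.
  apply/eqP/negPn/negP => /(kcomp_supp sw) /eqP.
  by rewrite cardsU1 lt.
exists (fun t => v t *m res_diff F i); split.
- by move=> t; exists (v t).
- by move=> t nz; apply: sv; apply: contraNneq nz => ->; rewrite mul0mx.
by move=> t; rewrite kdiff_mulmx -wv -kcomp_mulmx /kcomp zw.
Qed.

Lemma ksuppB (V : zmodType) j (w w' : {set 'I_N} -> V) :
  ksupp j w -> ksupp j w' -> ksupp j (fun t => w t - w' t).
Proof.
move=> h h' t nz; have [w0|/h //] := eqVneq (w t) 0.
by apply: h'; apply: contraNneq nz => w'0; rewrite w0 w'0 subr0.
Qed.

(** The exactness used in the connecting maps: [w] and [y] have the same boundary in degree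
[d], so their components differ by a boundary, the middle module being free. *)
Lemma kcomp_boundary b (e : 'I_b -> nat) j (w y : {set 'I_N} -> 'rV[R]_b) :
    (0 < j)%N -> ksupp j w -> ksupp j y ->
    (forall t, kcomp e d (kdiff w) t = kdiff y t) ->
  exists v, (forall t, kcomp e d w t - kcomp e d y t = kdiff v t) /\ ksupp j.+1 v.
Proof.
move=> j0 sw sy wy.
have compB t : kcomp e d (fun t => w t - y t) t = kcomp e d w t - kcomp e d y t.
  exact: row_compB.
have [||v [hv sv]] := @kcomp_exact _ e j (fun t => w t - y t) _ (ksuppB sw sy).
- by left.
- move=> t; rewrite -kcomp_kdiff /kcomp kdiffB row_compB.
  apply/eqP; rewrite subr_eq0; apply/eqP.
  rewrite -[LHS]row_comp_id; congr row_comp; exact: wy.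
by exists v; split=> // t; rewrite -compB.
Qed.

(** The connecting map of the exact sequence 0 -> Z_(i+1) -> F_(i+1) -> Z_i -> 0 embeds the
(j+1)-st Koszul homology of Z_i in the j-th one of Z_(i+1). *)
Lemma syzygy_acyclic_step i j : syzygy_acyclic i.+1 j -> syzygy_acyclic i j.+1.
Proof.
move=> acyc z hz sz kz; have [w [zw sw]] := lift_boundary hz sz.
have [|||y [hy sy wy]] := acyc (kdiff w).
- move=> t; have /res_exact [v ->] : kdiff w t *m res_diff F i = 0; last by exists v.
  by rewrite -kdiff_mulmx -[RHS](kz t); apply: eq_kdiff => s.
- exact: (kdiff_supp sw).
- exact: kdiff_kdiff.
have [//|v [wv sv]] := kcomp_boundary _ sw sy wy.
exists (fun t => v t *m res_diff F i); split.
- by move=> t; exists (v t).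
- by move=> t nz; apply: sv; apply: contraNneq nz => ->; rewrite mul0mx.
move=> t; rewrite kdiff_mulmx -wv mulmxBl -!kcomp_mulmx /kcomp.
suff -> : y t *m res_diff F i = 0 by rewrite row_comp0 subr0 zw.
by apply/res_exact; apply: hy.
Qed.

Lemma syzygy_acyclicT i j : d \notin syz_deg F (i + j).+1 -> syzygy_acyclic i j.
Proof.
elim: j i => [|j IHj] i; first by rewrite addn0; apply: syzygy_acyclic_base.
by rewrite addnS -addSn => /IHj; apply: syzygy_acyclic_step.
Qed.

Lemma idealB f g : I f -> I g -> I (f - g).
Proof.
case: idI => _ iD iM If Ig; apply: iD => //.
by rewrite -mulN1r; apply: iM.
Qed.

(** One more connecting map, for F_0 -> R/I, ends the comparison of the Koszul homology of R/I
with the generators of the resolution: a Koszul cycle modulo [I] that does not bound modulo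
[I] forces a syzygy of its degree. *)
Lemma koszul_cycle_bounds i (w : {set 'I_N} -> R) :
    d \notin syz_deg F i.+1 -> ksupp i.+1 w ->
    (forall t, in_twist #|t| d (w t)) -> (forall t, I (@kdiff _ _ R^o w t)) ->
  exists v : {set 'I_N} -> R, forall t, I (w t - @kdiff _ _ R^o v t).
Proof.
case: (idI) => I0 iD iM dF sw hw kw.
pose aug (u : rowF 0) : R := (u *m res_aug F) 0 0.
have augB u u' : aug (u - u') = aug u - aug u' by rewrite /aug mulmxBl !mxE.
have augL (a : R) x y : aug (a *: x + y) = a * aug x + aug y.
  by rewrite /aug mulmxDl -scalemxAl !mxE.
have aug_kdiff u t : aug (kdiff u t) = @kdiff _ _ R^o (aug \o u) t.
  by rewrite (@kdiff_linear _ _ _ R^o aug).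
have aug_comp u t : aug (kcomp (gen_deg 0) d u t) = twist_comp #|t| d (aug (u t)).
  have hA (p : 'I_(size (syz_deg F 0))) (q : 'I_1) :
      in_twist #|t| (gen_deg 0 p + #|t|) (res_aug F p q).
    rewrite -[X in in_twist X]add0n in_twistD /in_twist subn0 ord1.
    exact: res_aug_homog.
  have := @row_compM _ _ _ _ _ (fun _ => #|t|) d (u t) (res_aug F) hA.
  by move/rowP/(_ 0); rewrite mxE /aug /kcomp => <-.
have Icomp c f : I f -> I (twist_comp c d f).
  by move=> If; rewrite /twist_comp; case: (c <= d)%N; [apply: homI|exact: I0].
have [t|w' hw'] := @fin_skolem _ _ (fun t u => I (w t - aug u) /\ (u != 0 -> #|t| = i.+1)).
  have [w0|nz] := eqVneq (w t) 0.
    by exists 0; rewrite w0 eqxx /aug mul0mx mxE subr0.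
  by have [u hu] := res_aug_surj F (w t); exists u; split=> // _; apply: sw.
have sw' : ksupp i.+1 w' by move=> t; case: (hw' t).
have Iw' t : I (w t - aug (w' t)) by case: (hw' t).
have Isum (J : Type) (r : seq J) (P : pred J) (G : J -> R) :
    (forall j, P j -> I (G j)) -> I (\sum_(j <- r | P j) G j).
  by move=> h; elim/big_rec: _ => // j x Pj; apply: iD; apply: h.
have [|||y [hy sy wy]] := @syzygy_acyclicT 0 i dF (kdiff w').
- move=> t; apply/res_exact0; rewrite -/(aug _) aug_kdiff.
  have -> : @kdiff _ _ R^o (aug \o w') t
      = @kdiff _ _ R^o w t - @kdiff _ _ R^o (fun s => w s - aug (w' s)) t.
    by rewrite -kdiffB; apply: (@eq_kdiff _ _ R^o) => s; rewrite /= subKr.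
  by apply: idealB => //; apply: Isum => l _; apply: iM.
- exact: (kdiff_supp sw').
- exact: kdiff_kdiff.
have [//|v [wv sv]] := kcomp_boundary _ sw' sy wy.
exists (aug \o v) => t; rewrite -aug_kdiff -wv augB !aug_comp opprB addrA addrAC.
apply: iD; last by apply: Icomp; apply/res_exact0; apply: hy.
rewrite -{1}(twist_comp_id (hw t)) -twist_compB; exact: Icomp.
Qed.

End Chase.

(** * Syzygies of monomial ideals *)

Section MonomialIdeals.
Variables (k : fieldType) (N : nat).
Notation R := {mpoly k[N]}.
Notation mon := 'X_{1..N}.

Definition mon_ideal (P : pred mon) (f : R) : Prop := all P (msupp f).

Definition up_closed (P : pred mon) := forall m m', P m -> P (m' + m)%MM.

Variable P : pred mon.
Hypothesis upP : up_closed P.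

Lemma mon_idealX m : mon_ideal P 'X_[m] <-> P m.
Proof. by rewrite /mon_ideal msuppX /= andbT. Qed.

Lemma mon_ideal_ideal : is_ideal (mon_ideal P).
Proof.
split; first by rewrite /mon_ideal msupp0.
  move=> f g /allP hf /allP hg; apply/allP => m /msuppD_le.
  by rewrite mem_cat => /orP[/hf|/hg].
move=> f g /allP hg; apply/allP => m /msuppM_le /allpairsP[[m1 m2] /= [_ h ->]].
by apply/upP/hg.
Qed.

Lemma mon_ideal_pihomog d f : mon_ideal P f -> mon_ideal P (pihomog mdeg d f).
Proof.
move=> /allP hf; apply/allP => m; rewrite pihomogE => /msupp_sum_le.
case/flattenP => s /mapP[m' hm' ->] /msuppZ_le; rewrite msuppX inE => /eqP ->.
by apply: hf; move: hm'; rewrite mem_filter => /andP[].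
Qed.

Lemma msupp_ksgn l (s : {set 'I_N}) (f : R) : msupp (ksgn k l s * f) =i msupp f.
Proof.
move=> m; rewrite ksgnE mul_mpolyC !mcoeff_msupp mcoeffZ mulf_eq0.
by rewrite signr_eq0.
Qed.

(** The cycle is X^M / X_t at [t |: rho] and zero elsewhere: its boundary is in the ideal since
M stays there when [t] is exchanged for any element of [t |: rho]. If it were a boundary modulo
the ideal, then X^M, which is up to sign the coefficient at [rho] of its own boundary, would
appear in a sum of products X_l g with [l] outside [rho] and g in the ideal, so that X^M / X_l
would be in the ideal for some such [l]. *)
Lemma monomial_syzygy (char_k : [pchar k] =i pred0)
    (F : min_graded_resolution (mon_ideal P)) (M : mon) (rho : {set 'I_N}) t :
    t \notin rho -> (0 < M t)%N ->
    (forall l, l \in t |: rho -> P (U_(l) + (M - U_(t)))%MM) ->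
    (forall l, l \notin rho -> (0 < M l)%N -> ~~ P (M - U_(l))%MM) ->
  (mdeg M + #|rho|)%N \in syz_deg F #|rho|.+1.
Proof.
move=> trho Mt exch gen; apply/negPn/negP => dF.
have tM : (U_(t) + (M - U_(t)))%MM = M by rewrite addmC submK // lep1mP -lt0n.
have dM : mdeg M = (mdeg (M - U_(t))%MM).+1 by rewrite -{1}tM mdegD mdeg1 add1n.
pose w s : R := if s == t |: rho then 'X_[M - U_(t)] else 0.
have [iI0 _ iIM] := mon_ideal_ideal.
have [|||v hv] := @koszul_cycle_bounds _ _ char_k _ F mon_ideal_ideal mon_ideal_pihomog
  (mdeg M + #|rho|) #|rho| w dF.
- by move=> s; rewrite /w; case: (s =P _) => [->|_]; rewrite ?eqxx // cardsU1 trho.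
- move=> s; rewrite /w /in_twist; case: (s =P _) => [->|_]; last by rewrite dhomog0 eqxx; case: ifP.
  by rewrite cardsU1 trho dM addSn ltnS leq_addl subSS addnK dhomogX /=.
- move=> s; apply: big_rec; first exact: iI0.
  move=> l x ls hx; have [_ iD _] := mon_ideal_ideal; apply: iD => //.
  rewrite /w; case: eqP => [e|_]; last by rewrite scaler0.
  rewrite /GRing.scale /= -mulrA; apply: iIM.
  by rewrite -mpolyXD mon_idealX; apply: exch; rewrite -e setU11.
pose g s : R := w s - @kdiff _ _ R^o v s.
have e1 : @kdiff _ _ R^o g rho = @kdiff _ _ R^o w rho.
  by rewrite kdiffB kdiff_kdiff subr0.
have e2 : @kdiff _ _ R^o w rho = ksgn k t rho * 'X_[M].
  rewrite /kdiff (bigD1 t) //= big1 ?addr0 => [|l /andP[lr lt]].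
    by rewrite /w eqxx /GRing.scale /= -mulrA -mpolyXD tM.
  rewrite /w; case: eqP => [e|_]; last by rewrite scaler0.
  have : l \in t |: rho by rewrite -e setU11.
  by rewrite !inE (negPf lt) (negPf lr).
have : M \in msupp (@kdiff _ _ R^o g rho : R).
  by rewrite e1 e2 msupp_ksgn msuppX mem_head.
move=> /msupp_sum_le /flattenP[s /mapP[l]]; rewrite mem_filter => /andP[lr _] -> {s}.
rewrite /GRing.scale /= -mulrA msupp_ksgn mulrC (perm_mem (msuppMX _ _)) => /mapP[m' hm' eM].
have Pm' : P m' by move/allP: (hv (l |: rho)); apply.
have Ml : (0 < M l)%N by rewrite eM mnmDE mnm1E eqxx.
have := gen l lr Ml; suff -> : (M - U_(l))%MM = m' by rewrite Pm'.
by rewrite eM addmC addmK.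
Qed.

End MonomialIdeals.
Arguments mon_ideal_ideal {k N P}.
Arguments mon_idealX {k N P m}.

Section FatMonomials.
Variable N : nat.
Notation mon := 'X_{1..N}.

(** The monomials in the intersection of the [a l]-th powers of the ideals of the coordinate
points. *)
Definition fat_mon (a : 'I_N -> nat) (m : mon) := [forall l, (m l + a l <= mdeg m)%N].

Lemma fat_mon_up a : up_closed (fat_mon a).
Proof.
move=> m m' /forallP h; apply/forallP => l; rewrite mdegD mnmDE.
have := h l; have : (m' l <= mdeg m')%N by rewrite mdegE (bigD1 l) //= leq_addr.
lia.
Qed.

Lemma mdeg_sub1 (m : mon) l : (0 < m l)%N -> mdeg m = (mdeg (m - U_(l))%MM).+1.
Proof.
by move=> ml; rewrite -{1}(@submK _ U_(l)%MM m) ?lep1mP -?lt0n // mdegD mdeg1 addn1.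
Qed.

(** Say that [M] is tight at [l] when the condition at [l] is an equality. Exchanging [t] for a
variable where [M] is not tight preserves all the conditions; dividing [M] by a variable X_l
violates the condition at whichever of [t] and [t'] differs from [l]. *)
Lemma fat_syzygy (k : fieldType) (char_k : [pchar k] =i pred0) a
    (F : min_graded_resolution (mon_ideal (k := k) (fat_mon a))) (M : mon) (rho : {set 'I_N}) t t' :
    t != t' -> (0 < M t)%N ->
    (M t + a t = mdeg M)%N -> (M t' + a t' = mdeg M)%N -> fat_mon a M ->
    (forall l, l \in rho -> (M l + a l < mdeg M)%N) ->
  (mdeg M + #|rho|)%N \in syz_deg F #|rho|.+1.
Proof.
move=> tt' Mt et et' /forallP fM hrho.
have trho : t \notin rho by apply/negP => /hrho; rewrite et ltnn.
apply: (monomial_syzygy (fat_mon_up (a := a)) char_k F trho Mt).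
  move=> l; rewrite !inE => hl; apply/forallP => j.
  have -> : mdeg (U_(l) + (M - U_(t)))%MM = mdeg M by rewrite mdegD mdeg1 add1n -mdeg_sub1.
  rewrite mnmDE mnmBE !mnm1E.
  have [e|_] := eqVneq l j; last by rewrite add0n (leq_trans _ (fM j)) // leq_add2r leq_subr.
  subst j; have [e|ne] := eqVneq t l.
    by subst l; rewrite add1n subn1 prednK.
  by rewrite subn0 add1n addSn; apply: hrho; move: hl; rewrite eq_sym (negPf ne).
move=> l lr Ml; apply/forallPn => /=.
have bad j : j != l -> (M j + a j = mdeg M)%N ->
  ~~ ((M - U_(l))%MM j + a j <= mdeg (M - U_(l))%MM)%N.
  by move=> jl; rewrite mnmBE mnm1E eq_sym (negPf jl) subn0 (mdeg_sub1 Ml) => ->; rewrite ltnn.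
have [e|ne] := eqVneq t l; last by exists t; apply: bad.
by exists t'; apply: bad; rewrite // -e eq_sym.
Qed.

End FatMonomials.

(** * Powers of ideals generated by variables *)

Section IdealBasics.
Variable R : comNzRingType.

Lemma ideal_gen_ideal (S : R -> Prop) : is_ideal (ideal_gen S).
Proof.
split=> [J [] //|f g hf hg J iJ SJ|f g hg J iJ SJ]; have [J0 JD JM] := iJ.
  by apply: JD; [apply: hf|apply: hg].
by apply: JM; apply: hg.
Qed.

Lemma ideal_gen_sub (S : R -> Prop) f : S f -> ideal_gen S f.
Proof. by move=> Sf J _ SJ; apply: SJ. Qed.

Lemma ideal_sum (J : R -> Prop) (T : eqType) (r : seq T) (F : T -> R) :
  is_ideal J -> (forall x, x \in r -> J (F x)) -> J (\sum_(x <- r) F x).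
Proof.
move=> [J0 JD _] h; rewrite big_seq; elim/big_rec: _ => // x y xr; apply: JD; exact: h.
Qed.

End IdealBasics.

Section WeightIdeals.
Variables (k : fieldType) (N : nat).
Notation R := {mpoly k[N]}.
Notation mon := 'X_{1..N}.

(** The degree in the variables of [S]: powers of the ideal that they generate are
characterized by it, both for coordinate points and for the irrelevant ideal. *)
Definition wdeg (S : {set 'I_N}) (m : mon) := (\sum_(j in S) m j)%N.

Lemma wdegD S m m' : wdeg S (m + m')%MM = (wdeg S m + wdeg S m')%N.
Proof. by rewrite /wdeg -big_split; apply: eq_bigr => j _; rewrite mnmDE. Qed.

Lemma wdegU S l : wdeg S U_(l)%MM = (l \in S).
Proof.
rewrite /wdeg; case: (boolP (l \in S)) => lS.
  rewrite (bigD1 l) //= mnm1E eqxx big1 // => j /andP[_ ne].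
  by rewrite mnm1E eq_sym (negPf ne).
by rewrite big1 // => j jS; rewrite mnm1E; case: eqP => // e; rewrite e jS in lS.
Qed.

Lemma wdegT m : wdeg setT m = mdeg m.
Proof. by rewrite mdegE; apply: eq_bigl => j; rewrite inE. Qed.

Lemma wdegC1 l (m : mon) : (m l + wdeg [set~ l] m)%N = mdeg m.
Proof.
by rewrite mdegE [RHS](bigD1 l) //=; congr (_ + _)%N; apply: eq_bigl => j; rewrite !inE.
Qed.

Definition wge S a : pred mon := fun m => (a <= wdeg S m)%N.

Lemma wge_up S a : up_closed (wge S a).
Proof. by move=> m m'; rewrite /wge wdegD => h; rewrite (leq_trans h) // leq_addl. Qed.

Lemma mon_ideal_min (P : pred mon) (J : R -> Prop) :
  is_ideal J -> (forall m, P m -> J 'X_[m]) -> ideal_le (mon_ideal P) J.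
Proof.
move=> iJ h f /allP hf; rewrite [f]mpolyE; apply: ideal_sum => // m /hf Pm.
by rewrite -mul_mpolyC; case: iJ => _ _; apply; apply: h.
Qed.

Lemma ideal_pow_wge S (J : R -> Prop) : (forall f, J f <-> mon_ideal (wge S 1) f) ->
  forall a f, ideal_pow J a f <-> mon_ideal (wge S a) f.
Proof.
move=> hJ; elim=> [|a IHa] f; first by split=> // _; apply/allP.
split.
  apply; first exact: mon_ideal_ideal (@wge_up _ _).
  move=> _ [g [h [/hJ/allP hg /IHa/allP hh ->]]]; apply/allP => m /msuppM_le.
  case/allpairsP => -[m1 m2] /= [/hg h1 /hh h2 ->].
  by rewrite /wge wdegD -addn1 addnC leq_add.
apply: mon_ideal_min; first exact: ideal_gen_ideal.
move=> m hm; have [j jS mj] : exists2 j, j \in S & (0 < m j)%N.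
  apply/exists_inP; apply: contraLR hm => /exists_inPn nz.
  rewrite /wge /wdeg big1 // => j /nz; by rewrite -eqn0Ngt => /eqP.
have e : (U_(j) + (m - U_(j)))%MM = m by rewrite addmC submK // lep1mP -lt0n.
apply: ideal_gen_sub; exists 'X_j, 'X_[m - U_(j)]; split.
- by apply/hJ/mon_idealX; rewrite /wge wdegU jS.
- by apply/IHa/mon_idealX; move: hm; rewrite /wge -{1}e wdegD wdegU jS.
- by rewrite -mpolyXD e.
Qed.

Lemma irrelevant_wge f : @irrelevant k N f <-> mon_ideal (wge setT 1) f.
Proof.
split.
  apply; first exact: mon_ideal_ideal (@wge_up _ _).
  by move=> _ [i ->]; apply/mon_idealX; rewrite /wge wdegU inE.
apply: mon_ideal_min; first exact: ideal_gen_ideal.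
move=> m; rewrite /wge wdegT lt0n mdeg_eq0 => nz.
have [j mj] : exists j, (0 < m j)%N.
  apply/existsP; apply: contraNT nz => /existsPn nz; apply/eqP/mnmP => j.
  by rewrite mnm0E; apply/eqP; move: (nz j); rewrite -eqn0Ngt.
have e : ((m - U_(j)) + U_(j))%MM = m by rewrite submK // lep1mP -lt0n.
rewrite -e mpolyXD; have [_ _ iM] := ideal_gen_ideal (fun f : R => exists i, f = 'X_i).
by apply: iM; apply: ideal_gen_sub; exists j.
Qed.

(** A form of degree d vanishes at the [l]-th coordinate point exactly when it has no
monomial X_l^d. *)
Lemma point_ideal_wge l f :
  point_ideal (delta_mx 0 l : 'rV[k]_N) f <-> mon_ideal (wge [set~ l] 1) f.
Proof.
split.
  apply; first exact: mon_ideal_ideal (@wge_up _ _).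
  move=> {}f [[d /dhomogP hd] f0]; apply/allP => m mf; rewrite /wge lt0n.
  apply/negP => /eqP w0.
  have offl (m' : mon) j : wdeg [set~ l] m' = 0%N -> j != l -> m' j = 0%N.
    by move/eqP; rewrite sum_nat_eq0 => /forall_inP h jl; apply/eqP/h; rewrite !inE.
  move: f0; rewrite mevalE (bigD1_seq m) ?msupp_uniq //= [X in _ + X]big_seq_cond [X in _ + X]big1 ?addr0.
    rewrite big1 ?mulr1 => [f0|j _]; first by move: mf; rewrite mcoeff_msupp f0 eqxx.
    by rewrite mxE /=; have [->|jl] := eqVneq j l; rewrite ?expr1n // offl // expr0.
  move=> m' /andP[m'f ne].
  have [j [jl mj]] : exists j, j != l /\ (0 < m' j)%N.
    suff /existsP[j /andP[]] : [exists j, (j != l) && (0 < m' j)%N] by exists j.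
    apply: contraNT ne => /existsPn h.
    have z j : j != l -> m' j = 0%N.
      by move=> jl; have := h j; rewrite jl -eqn0Ngt => /eqP.
    apply/eqP/mnmP => j; have [->|jl] := eqVneq j l; last by rewrite z // offl.
    have w' : wdeg [set~ l] m' = 0%N by apply: big1 => i; rewrite !inE; apply: z.
    have : mdeg m = mdeg m' by apply: etrans (hd _ mf) (esym (hd _ m'f)).
    rewrite -(wdegC1 l m) -(wdegC1 l m') w0 w'.
    by rewrite !addn0.
  by rewrite (bigD1 j) //= mxE (negPf jl) expr0n eqn0Ngt mj mul0r mulr0.
apply: mon_ideal_min; first exact: ideal_gen_ideal.
move=> m hm; have [j jl mj] : exists2 j, j != l & (0 < m j)%N.
  apply/exists_inP; apply: contraLR hm => /exists_inPn nz.
  rewrite /wge /wdeg big1 // => j; rewrite !inE => /nz; by rewrite -eqn0Ngt => /eqP.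
have e : ((m - U_(j)) + U_(j))%MM = m by rewrite submK // lep1mP -lt0n.
rewrite -e mpolyXD.
have [_ _ iM] : is_ideal (point_ideal (delta_mx 0 l : 'rV[k]_N)) by apply: ideal_gen_ideal.
apply: iM; apply: ideal_gen_sub; split; first by exists 1%N; rewrite dhomogX /= mdeg1.
by rewrite mevalXU mxE (negPf jl).
Qed.

Lemma fat_mon_wge a m : fat_mon a m <-> forall l, wge [set~ l] (a l) m.
Proof.
split=> [/forallP h l|h]; last apply/forallP => l; move: (h l);
  by rewrite /wge -(wdegC1 l) leq_add2l.
Qed.

End WeightIdeals.

(** * Linear changes of coordinates *)

Section PullBack.
Variable R : comNzRingType.
Implicit Types (I J P : R -> Prop) (h : {rmorphism R -> R}).

Lemma ideal_pull h J : is_ideal J -> is_ideal (fun f => J (h f)).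
Proof.
move=> [J0 JD JM]; split=> [|f g|f g]; rewrite ?rmorph0 ?rmorphD ?rmorphM //.
  exact: JD.
exact: JM.
Qed.

Lemma prime_pull h P : is_prime P -> is_prime (fun f => P (h f)).
Proof.
move=> [iP P1 PM]; split; first exact: ideal_pull.
  by rewrite rmorph1.
by move=> f g; rewrite rmorphM; apply: PM.
Qed.

Lemma chain_pull h (g : R -> R) P n : cancel g h ->
  prime_chain P n -> prime_chain (fun f => P (h f)) n.
Proof.
move=> gK [Q [Qp Qs QP]]; exists (fun i f => Q i (h f)); split=> [i /Qp|i /Qs[le nle]|f //].
  exact: prime_pull.
by split=> [f /le //|nle']; apply: nle => f Qf; rewrite -[f]gK; apply: nle'; rewrite gK.
Qed.

Lemma chain_ext P P' n : (forall f, P f <-> P' f) -> prime_chain P n -> prime_chain P' n.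
Proof.
move=> PP' [Q [Qp Qs QP]]; exists Q; split=> // f; apply: iff_trans (QP f) (PP' f).
Qed.

Lemma height_pull h (g : {rmorphism R -> R}) P n : cancel g h -> cancel h g ->
  prime_height P n -> prime_height (fun f => P (h f)) n.
Proof.
move=> gK hK [Pn Pmax]; split; first exact: chain_pull gK Pn.
move=> n' /(chain_pull hK) /= Pn'; apply: Pmax; apply: chain_ext Pn' => f.
by rewrite gK.
Qed.

Variables phi psi : {rmorphism R -> R}.
Hypotheses (phiK : cancel phi psi) (psiK : cancel psi phi).

Definition corresp I J := forall f, I f <-> J (phi f).

Lemma corresp_sym I J g : corresp I J -> J g <-> I (psi g).
Proof. by move=> c; rewrite (c (psi g)) psiK. Qed.

Lemma corresp_gen S S' : corresp S S' -> corresp (ideal_gen S) (ideal_gen S').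
Proof.
move=> c f; split=> hf J iJ SJ.
  apply: (hf (fun f => J (phi f))); first exact: ideal_pull.
  by move=> g /c; apply: SJ.
rewrite -(phiK f); apply: (hf (fun f => J (psi f))); first exact: ideal_pull.
by move=> g /(corresp_sym _ c); apply: SJ.
Qed.

Lemma corresp_mul I J I' J' : corresp I I' -> corresp J J' ->
  corresp (ideal_mul I J) (ideal_mul I' J').
Proof.
move=> cI cJ; apply: corresp_gen => f; split=> -[g [h [hg hh e]]].
  by exists (phi g), (phi h); split; [apply/cI|apply/cJ|rewrite e rmorphM].
exists (psi g), (psi h); split; [by apply/(corresp_sym _ cI)|by apply/(corresp_sym _ cJ)|].
by rewrite -rmorphM -e phiK.
Qed.

Lemma corresp_pow I I' a : corresp I I' -> corresp (ideal_pow I a) (ideal_pow I' a).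
Proof. by move=> c; elim: a => [|a IHa] //=; apply: corresp_mul. Qed.

Lemma corresp_add I J I' J' : corresp I I' -> corresp J J' ->
  corresp (ideal_add I J) (ideal_add I' J').
Proof.
move=> cI cJ f; split=> -[g [h [hg hh e]]].
  by exists (phi g), (phi h); split; [apply/cI|apply/cJ|rewrite e rmorphD].
exists (psi g), (psi h); split; [by apply/(corresp_sym _ cI)|by apply/(corresp_sym _ cJ)|].
by rewrite -rmorphD -e phiK.
Qed.

Lemma corresp_codim I J c : corresp I J -> codimension I c -> codimension J c.
Proof.
move=> cIJ [[P [Pp IP Ph]] Pmin]; split.
  exists (fun f => P (psi f)); split.
  - exact: prime_pull.
  - by move=> f /(corresp_sym _ cIJ); apply: IP.
  - exact: height_pull phiK psiK Ph.
move=> Q h Qp JQ Qh; apply: (Pmin (fun f => Q (phi f))).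
- exact: prime_pull.
- by move=> f /cIJ; apply: JQ.
- exact: height_pull psiK phiK Qh.
Qed.

End PullBack.

Section LinearChange.
Variables (k : fieldType) (N : nat).
Notation R := {mpoly k[N]}.

(** The matrix is transposed in the linear forms so that the value of [linsub A f] at the row
[v] is the value of [f] at [v *m A]. *)
Definition linsub (A : 'M[k]_N) (f : R) : R := f \mPo [tuple \sum_j A j i *: 'X_j | i < N].

HB.instance Definition _ A := GRing.RMorphism.copy (linsub A) (comp_mpoly [tuple \sum_j A j i *: 'X_j | i < N]).
HB.instance Definition _ A := GRing.Linear.copy (linsub A) (comp_mpoly [tuple \sum_j A j i *: 'X_j | i < N]).

Lemma linsubX A i : linsub A 'X_i = \sum_j A j i *: 'X_j.
Proof. by rewrite /linsub comp_mpolyXU -tnth_nth tnth_mktuple. Qed.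

Lemma linsub_meval A (f : R) (v : 'rV_N) :
  (linsub A f).@[fun j => v 0 j] = f.@[fun j => (v *m A) 0 j].
Proof.
rewrite comp_mpoly_meval; apply: meval_eq => i; rewrite tnth_mktuple raddf_sum mxE.
by apply: eq_bigr => j _ /=; rewrite mevalZ mevalXU mulrC.
Qed.

Lemma linsubM A B f : linsub B (linsub A f) = linsub (B *m A) f.
Proof.
rewrite {1 2}[f]mpolyE (raddf_sum (linsub A)) (raddf_sum (linsub B)) (raddf_sum (linsub (B *m A))); apply: eq_bigr => m _ /=.
rewrite !linearZ /=; congr (_ *: _); rewrite mpolyXE_id !rmorph_prod; apply: eq_bigr => i _.
rewrite !rmorphXn /=; congr (_ ^+ _); rewrite !linsubX raddf_sum /=.
under eq_bigr => j _ do rewrite linearZ /= linsubX scaler_sumr.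
rewrite exchange_big; apply: eq_bigr => l _ /=; rewrite mxE scaler_suml.
by apply: eq_bigr => j _; rewrite scalerA mulrC.
Qed.

Lemma linsub1 f : linsub 1%:M f = f.
Proof.
rewrite -[RHS]comp_mpoly_id; congr comp_mpoly; apply: eq_from_tnth => i.
rewrite !tnth_mktuple (bigD1 i) //= mxE eqxx scale1r big1 ?addr0 // => j ji.
by rewrite mxE (negPf ji) scale0r.
Qed.

Lemma linsub_homog A d f : f \is d.-homog -> linsub A f \is d.-homog.
Proof.
move=> /dhomogP hf; rewrite [f]mpolyE raddf_sum big_seq rpred_sum // => m /hf <- /=.
rewrite linearZ dhomogZ //= mpolyXE_id rmorph_prod /= mdegE.
elim/big_rec2: _ => [|i p q _ hp]; first exact: dhomog1.
apply: dhomogM => //; rewrite rmorphXn /= linsubX.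
suff h : \sum_j A j i *: 'X_j \is 1.-homog by have := dhomogMn (m i) h; rewrite mul1n.
by rewrite rpred_sum // => j _; rewrite dhomogZ // dhomogX /= mdeg1.
Qed.

Section Invertible.
Variable A : 'M[k]_N.
Hypothesis uA : A \in unitmx.

Lemma linsubK : cancel (linsub A) (linsub (invmx A)).
Proof. by move=> f; rewrite linsubM mulVmx ?linsub1. Qed.

Lemma linsubVK : cancel (linsub (invmx A)) (linsub A).
Proof. by move=> f; rewrite linsubM mulmxV ?linsub1. Qed.

Lemma linsub_homogE d f : f \is d.-homog <-> linsub A f \is d.-homog.
Proof. by split=> [|h]; [apply: linsub_homog|rewrite -(linsubK f) linsub_homog]. Qed.

Lemma linsub_in_twist e d f : in_twist e d f -> in_twist e d (linsub A f).
Proof.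
by rewrite /in_twist; case: leqP => [_|_ /eqP ->]; [apply: linsub_homog|rewrite rmorph0].
Qed.

Lemma point_ideal_linsub (v : 'rV[k]_N) :
  corresp (linsub A) (point_ideal (v *m A)) (point_ideal v).
Proof.
apply: (corresp_gen linsubK linsubVK) => f; rewrite linsub_meval.
by split=> -[[d hd] f0]; split=> //; exists d; [exact: (linsub_homogE d f).1 hd|exact: (linsub_homogE d f).2 hd].
Qed.

Lemma linsub_irrelevant B (f : R) : irrelevant f -> irrelevant (linsub B f).
Proof.
have iI : is_ideal (@irrelevant k N) by apply: ideal_gen_ideal.
move=> /(_ (fun g => irrelevant (linsub B g))); apply; first exact: ideal_pull iI.
move=> _ [i ->]; rewrite linsubX; apply: ideal_sum => // j _; rewrite -mul_mpolyC.
by case: iI => _ _; apply; apply: ideal_gen_sub; exists j.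
Qed.

Lemma irrelevant_linsub : corresp (linsub A) (@irrelevant k N) (@irrelevant k N).
Proof.
move=> f; split; first exact: linsub_irrelevant.
by move/(linsub_irrelevant (invmx A)); rewrite linsubK.
Qed.

Lemma quot_dim_linsub (I J : R -> Prop) h : corresp (linsub A) I J ->
  quot_dim I h -> quot_dim J h.
Proof.
move=> cIJ [b [gen free]]; exists (fun i => linsub A (b i)).
have lin (c : 'I_h -> k) : \sum_i c i *: linsub A (b i) = linsub A (\sum_i c i *: b i).
  by rewrite raddf_sum; apply: eq_bigr => i _; rewrite /= linearZ.
split=> [f|c]; last by rewrite lin => /cIJ; apply: free.
have [c hc] := gen (linsub (invmx A) f); exists c; rewrite lin.
by move/cIJ: hc; rewrite rmorphB /= linsubVK.
Qed.

Lemma multiplicity_linsub (I J : R -> Prop) e : corresp (linsub A) I J ->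
  multiplicity I e -> multiplicity J e.
Proof.
move=> cIJ [Q [t0 hQ] ->]; exists Q => //; exists t0 => t /hQ[h hI hQt]; exists h => //.
apply: quot_dim_linsub hI; apply: (corresp_add linsubK linsubVK) => //.
by apply: (corresp_pow linsubK linsubVK); apply: irrelevant_linsub.
Qed.

Lemma resolution_linsub (I J : R -> Prop) (F : min_graded_resolution I) :
  corresp (linsub A) I J ->
  exists F' : min_graded_resolution J, syz_deg F' = syz_deg F.
Proof.
move=> cIJ; pose B := invmx A.
have mapK m n (M : 'M[R]_(m, n)) : map_mx (linsub A) (map_mx (linsub B) M) = M.
  by apply/matrixP => i j; rewrite !mxE linsubVK.
have mapVK m n (M : 'M[R]_(m, n)) : map_mx (linsub B) (map_mx (linsub A) M) = M.
  by apply/matrixP => i j; rewrite !mxE linsubK.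
have augE (u : 'rV_(size (syz_deg F 0))) :
    (u *m map_mx (linsub A) (res_aug F)) 0 0 = linsub A ((map_mx (linsub B) u *m res_aug F) 0 0).
  by rewrite -{1}(mapK _ _ u) -map_mxM mxE.
have diffE i (v : 'rV_(size (syz_deg F i.+1))) :
    v *m map_mx (linsub A) (res_diff F i) = map_mx (linsub A) (map_mx (linsub B) v *m res_diff F i).
  by rewrite map_mxM mapK.
unshelve eexists (@MinGradedResolution k N J (syz_deg F) (map_mx (linsub A) (res_aug F))
  (fun i => map_mx (linsub A) (res_diff F i)) _ _ _ _ _ _) => //.
- by move=> q; rewrite mxE; apply: linsub_homog; apply: res_aug_homog.
- by move=> i p q; rewrite mxE; apply: linsub_in_twist; apply: res_diff_homog.
- move=> f; have [u hu] := res_aug_surj F (linsub B f); exists (map_mx (linsub A) u).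
  by move/cIJ: hu; rewrite augE mapVK rmorphB /= linsubVK.
- move=> u; rewrite augE -cIJ res_exact0; split=> -[v e].
    by exists (map_mx (linsub A) v); rewrite diffE mapVK -e mapK.
  by exists (map_mx (linsub B) v); rewrite e diffE mapVK.
- move=> i u; rewrite diffE.
  have -> : map_mx (linsub A) (map_mx (linsub B) u *m res_diff F i) = 0
      <-> map_mx (linsub B) u *m res_diff F i = 0.
    by split=> [/(congr1 (map_mx (linsub B)))|->]; rewrite ?mapVK map_mx0.
  rewrite res_exact; split=> -[v e].
    by exists (map_mx (linsub A) v); rewrite diffE mapVK -e mapK.
  by exists (map_mx (linsub B) v); rewrite e diffE mapVK.
- by move=> i p q; rewrite mxE; apply: linsub_irrelevant; apply: res_minimal.
Qed.

End Invertible.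

End LinearChange.

Section FatPoints.
Variables (k : fieldType) (n r : nat).
Hypothesis le_rn : (r <= n)%N.

(** Coordinate points outside the given set count as points of multiplicity 0, which puts all
the variables on the same footing. *)
Definition extend_mult (a : 'I_r.+1 -> nat) (l : 'I_n.+1) : nat := oapp a 0%N (insub (val l)).

Lemma extend_mult_widen a i : extend_mult a (widen_ord (le_rn : (r < n.+1)%N) i) = a i.
Proof. by rewrite /extend_mult /= valK. Qed.

Lemma row_free_completion (P : 'M[k]_(r.+1, n.+1)) : row_free P ->
  exists2 A : 'M[k]_n.+1, A \in unitmx &
    forall i, row i P = delta_mx 0 (widen_ord (le_rn : (r < n.+1)%N) i) *m A.
Proof.
move=> freeP; have rkP : \rank P = r.+1 by apply/eqP.
(* the nonzero rows of P^C are the last ones, so the sum places the rows of P above them *)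
pose A : 'M_n.+1 := pid_mx r.+1 *m P + P^C%MS.
have PA : (pid_mx r.+1 : 'M_(r.+1, n.+1)) *m A = P.
  rewrite mulmxDr mulmxA pid_mx_id // pid_mx_1 mul1mx /complmx rkP mulmxA.
  by rewrite mul_pid_mx_copid // mul0mx addr0.
have CA : copid_mx r.+1 *m A = P^C%MS.
  by rewrite mulmxDr mulmxA mul_copid_mx_pid // mul0mx add0r /complmx rkP mulmxA copid_mx_id.
exists A.
  rewrite -row_full_unit -sub1mx (submx_trans _ (_ : (P + P^C <= A)%MS)) //.
    by rewrite sub1mx; apply: addsmx_compl_full.
  by rewrite addsmx_sub -{1}PA -CA !submxMl.
move=> i; rewrite -{1}PA row_mul; congr (_ *m _); apply/rowP => j; rewrite !mxE /=.
by rewrite -val_eqE /= ltn_ord andbT eq_sym.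
Qed.

Lemma fat_points_linsub (P : 'M[k]_(r.+1, n.+1)) (a : 'I_r.+1 -> nat) (A : 'M[k]_n.+1) :
    A \in unitmx ->
    (forall i, row i P = delta_mx 0 (widen_ord (le_rn : (r < n.+1)%N) i) *m A) ->
  corresp (linsub A) (fat_points_ideal P a) (mon_ideal (fat_mon (extend_mult a))).
Proof.
move=> uA PA f.
have c i : ideal_pow (point_ideal (row i P)) (a i) f
    <-> mon_ideal (wge [set~ widen_ord (le_rn : (r < n.+1)%N) i] (a i)) (linsub A f).
  rewrite PA (corresp_pow (linsubK uA) (linsubVK uA) _ (point_ideal_linsub uA _)).
  exact: ideal_pow_wge (@point_ideal_wge _ _ _) _ _.
split=> [h|/allP h i].
  apply/allP => m mf; apply/fat_mon_wge => l; rewrite /extend_mult.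
  case: insubP => [i _ e|] //=; have /c/allP/(_ m mf) := h i.
  by congr (wge [set~ _] _ _); apply: val_inj.
by apply/c/allP => m /h/fat_mon_wge/(_ (widen_ord (le_rn : (r < n.+1)%N) i)); rewrite extend_mult_widen.
Qed.

End FatPoints.

(** * Codimension of fat points *)

Section CoefficientMatrix.
Variables (k : fieldType) (N h s : nat).
Notation R := {mpoly k[N]}.
Variables (b : 'I_h -> R) (m : 'I_s -> 'X_{1..N}).

Let B : 'M[k]_(h, s) := \matrix_(i, j) (b i)@_(m j).

Lemma coeff_combination (c : 'I_h -> k) j :
  (\sum_i c i *: b i)@_(m j) = ((\row_i c i) *m B) 0 j.
Proof. by rewrite raddf_sum mxE; apply: eq_bigr => i _ /=; rewrite mcoeffZ !mxE. Qed.

Lemma independent_le :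
  (forall c : 'I_h -> k, (forall j, (\sum_i c i *: b i)@_(m j) = 0) -> forall i, c i = 0) ->
  (h <= s)%N.
Proof.
move=> ind; suff /eqP <- : row_free B by apply: rank_leq_col.
rewrite -kermx_eq0; apply/eqP/row_matrixP => i; rewrite row0; apply/rowP => j.
rewrite [RHS]mxE; apply: (ind (fun j => row i (kermx B) 0 j)) => l.
rewrite coeff_combination; have -> : \row_j row i (kermx B) 0 j = row i (kermx B).
  by apply/rowP => j'; rewrite mxE.
by rewrite -row_mul mulmx_ker !mxE.
Qed.

Lemma spanning_ge : injective m ->
  (forall j, exists c : 'I_h -> k, forall j', ('X_[m j] - \sum_i c i *: b i)@_(m j') = 0) ->
  (s <= h)%N.
Proof.
move=> inj span; suff /eqP <- : row_full B by apply: rank_leq_row.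
rewrite -sub1mx; apply/row_subP => j; have [c hc] := span j.
have -> : row j 1%:M = (\row_i c i) *m B; last exact: submxMl.
apply/rowP => j'; rewrite -coeff_combination; have /eqP := hc j'.
by rewrite raddfB subr_eq0 /= mcoeffX => /eqP <-; rewrite !mxE (inj_eq inj).
Qed.

End CoefficientMatrix.

Section Dimension.
Variables (k : fieldType) (N : nat).
Notation R := {mpoly k[N]}.

Lemma card_bmultinom D : (#|{: 'X_{1..N < D}}| <= D ^ N)%N.
Proof.
case: D => [|D].
  rewrite -[X in (X <= _)%N](_ : 0%N = _) //.
  by apply/esym/eqP; apply/pred0P => -[m].
rewrite -[X in (_ <= X ^ _)%N]card_ord -[X in (_ <= _ ^ X)%N]card_ord -card_ffun.
have inj : injective (fun m : 'X_{1..N < D.+1} => [ffun i => inord (m i) : 'I_D.+1]).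
  move=> m m' /ffunP e; apply/val_inj/mnmP => i.
  have := congr1 val (e i); rewrite !ffunE /= !inordK //.
    by rewrite (leq_ltn_trans _ (bmdeg m')) // mdegE (bigD1 i) //= leq_addr.
  by rewrite (leq_ltn_trans _ (bmdeg m)) // mdegE (bigD1 i) //= leq_addr.
exact: leq_card inj.
Qed.

Definition indep_mod (Q : R -> Prop) (A : finType) (g : A -> R) :=
  forall c : A -> k, Q (\sum_x c x *: g x) -> forall x, c x = 0.

Lemma primeX_notin (Q : R -> Prop) f e : is_prime Q -> ~ Q f -> ~ Q (f ^+ e).
Proof.
move=> [_ Q1 QM] Qf; elim: e => [|e IHe]; first by rewrite expr0.
by rewrite exprS => /QM[].
Qed.

Lemma prime_le_ideal (Q : R -> Prop) f g : is_ideal Q -> Q (f + g) -> Q g -> Q f.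
Proof.
move=> [_ QD QM] Qfg Qg; rewrite -(addrK g f); apply: QD => //.
by rewrite -mulN1r; apply: QM.
Qed.

(** In a linear relation modulo [Q], the lowest power of [f] can be factored out since [Q] is
prime; the remaining factor is, modulo [Q'], a relation between the [g x]. *)
Lemma indep_mod_powers (Q Q' : R -> Prop) f (A : finType) (g : A -> R) s :
    is_prime Q -> is_prime Q' -> ideal_le Q Q' -> Q' f -> ~ Q f -> indep_mod Q' g ->
  indep_mod Q (fun x : 'I_s.+1 * A => f ^+ x.1 * g x.2).
Proof.
move=> pQ pQ' QQ' Q'f Qf ind c Qc.
pose G e := \sum_a c (e, a) *: g a.
have eqG : \sum_x c x *: (f ^+ x.1 * g x.2) = \sum_(e < s.+1) f ^+ e * G e.
  rewrite (eq_bigr (fun x => c (x.1, x.2) *: (f ^+ x.1 * g x.2))); last by case.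
  rewrite -(pair_bigA _ (fun e a => c (e, a) *: (f ^+ e * g a))) /=.
  by apply: eq_bigr => e _; rewrite mulr_sumr; apply: eq_bigr => a _; rewrite scalerAr.
rewrite {}eqG in Qc.
suff z e : (e < s.+1)%N -> forall i : 'I_s.+1, i = e :> nat -> forall a, c (i, a) = 0.
  by move=> [e a]; apply: (z e).
elim/ltn_ind: e => e IHe lte i ie a.
have [iQ' _ _] := pQ'; have [_ _ Q'M] := iQ'; have [_ _ QM] := pQ.
pose T := \sum_(j < s.+1 | (e < j)%N) f ^+ (j - e.+1) * G j.
have : Q (f ^+ e * (G i + f * T)).
  suff <- : \sum_(j < s.+1) f ^+ j * G j = f ^+ e * (G i + f * T) by [].
  rewrite (bigID (fun j : 'I_s.+1 => (j < e)%N)) /= big1 ?add0r; last first.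
    move=> j je; suff -> : G j = 0 by rewrite mulr0.
    by apply: big1 => a' _; rewrite (IHe j) ?scale0r // (ltn_trans je).
  rewrite (bigD1 i) /=; last by rewrite ie ltnn.
  rewrite ie mulrDr; congr (_ + _); rewrite mulrA -exprSr mulr_sumr.
  apply: eq_big => [j|j]; first by rewrite -leqNgt ltn_neqAle andbC eq_sym -val_eqE /= ie.
  rewrite -leqNgt => /andP[le ne]; rewrite mulrA -exprD addSn -addnS subnSK ?subnKC //.
  by rewrite ltn_neqAle le andbT eq_sym -[X in _ != X]ie.
case/QM => [Qfe|/QQ' Q'G]; first by case: (primeX_notin pQ Qf Qfe).
apply: (ind (fun a => c (i, a))); apply: prime_le_ideal iQ' Q'G _.
by rewrite mulrC; apply: Q'M.
Qed.

Lemma msize_mul_le (p q : R) : (msize (p * q) <= (msize p + msize q).-1)%N.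
Proof.
have [->|nzp] := eqVneq p 0; first by rewrite mul0r msize0.
have [->|nzq] := eqVneq q 0; first by rewrite mulr0 msize0.
by rewrite msizeM.
Qed.

(** Climbing down a chain of primes from the top, each step multiplies an independent family
by the first powers of one more element. *)
Lemma chain_indep (Q : nat -> R -> Prop) h :
    (forall i, (i <= h)%N -> is_prime (Q i)) ->
    (forall i, (i < h)%N -> ideal_le (Q i) (Q i.+1) /\ ~ ideal_le (Q i.+1) (Q i)) ->
  forall j, (j <= h)%N -> exists D, forall s, exists (A : finType) (g : A -> R),
    [/\ #|A| = (s.+1 ^ j)%N, indep_mod (Q (h - j)%N) g & forall x, (msize (g x) <= (D * s).+1)%N].
Proof.
move=> Qp Qs; elim=> [|j IHj] jh.
  exists 0%N => s; exists unit, (fun=> 1); split; first by rewrite card_unit.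
    move=> c; rewrite (bigD1 tt) //= big1 ?addr0 => [Qc []|[]] //.
    apply/eqP/negPn/negP => nz; have [[_ _ QM] Q1 _] := Qp _ (leq_subr 0 h); apply: Q1.
    have := QM (c tt)^-1%:MP _ Qc.
    by rewrite mul_mpolyC scalerA mulVf // scale1r.
  by move=> x; rewrite msize1.
have [D hD] := IHj (ltnW jh).
have lt : (h - j.+1 < h)%N by rewrite ltn_subrL /= (leq_ltn_trans _ jh).
have [le nle] := Qs _ lt.
have [f nf] := not_all_ex_not _ _ nle; have [Q'f Qf] := imply_to_and _ _ nf.
rewrite subnSK // in le Q'f.
exists (D + msize f)%N => s; have [A [g [cA ig sg]]] := hD s.
exists ('I_s.+1 * A)%type, (fun x : 'I_s.+1 * A => f ^+ x.1 * g x.2); split.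
- by rewrite card_prod card_ord cA expnS.
- exact: indep_mod_powers (Qp _ (ltnW lt)) (Qp _ (leq_subr _ _)) le Q'f Qf ig.
move=> [e x] /=.
have sfe : (msize (f ^+ e) <= (e * msize f).+1)%N.
  elim: {x}(e : nat) => [|i IHi]; first by rewrite expr0 msize1.
  rewrite exprS (leq_trans (msize_mul_le _ _)) // mulSn.
  by move: IHi; move: (msize f) (msize _) => u v; lia.
rewrite (leq_trans (msize_mul_le _ _)) //; move: (sg x) (ltn_ord e) sfe.
move: (msize f) (msize (g x)) (msize (f ^+ _)) => u v w h1 h2 h3.
have h4 : (e * u <= s * u)%N by rewrite leq_mul2r -ltnS h2 orbT.
by move: h1 h3 h4; rewrite mulnDl [(u * s)%N]mulnC; lia.
Qed.

(** The elements that separate the primes of the chain have s ^ h independent products of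
degree O(s), whereas polynomials of degree O(s) in N variables span a space of dimension
O(s ^ N). *)
Lemma chain_length_le (P : R -> Prop) h : prime_chain P h -> (h <= N)%N.
Proof.
move=> [Q [Qp Qs _]]; have [D hD] := chain_indep Qp Qs (leqnn h).
rewrite leqNgt; apply/negP => Nh.
have [A [g [cA ig sg]]] := hD (D.+1 ^ N)%N; set s := (D.+1 ^ N)%N in cA sg.
rewrite subnn in ig.
have [[Q0 _ _] _ _] := Qp 0%N (leq0n _).
have le : (#|A| <= #|{: 'X_{1..N < (D * s).+1}}|)%N.
  apply: (@independent_le k N _ _ (fun i => g (enum_val i)) (fun j => val (enum_val j))).
  move=> c hc i; rewrite -(enum_valK i).
  apply: (ig (fun x => c (enum_rank x))).
  rewrite (reindex (@enum_val A A)) /=; last exact: onW_bij (enum_val_bij _).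
  under eq_bigr => j _ do rewrite enum_valK.
  suff -> : \sum_i c i *: g (enum_val i) = 0 by [].
  apply/mpolyP => m; rewrite mcoeff0.
  case: (ltnP (mdeg m) (D * s).+1) => [lt|ge].
    by have := hc (enum_rank (BMultinom lt)); rewrite enum_rankK.
  rewrite raddf_sum big1 //= => j _; rewrite mcoeffZ memN_msupp_eq0 ?mulr0 //.
  by apply: msize_mdeg_ge; apply: leq_trans (sg _) ge.
have := leq_trans le (card_bmultinom _); rewrite cA leqNgt; apply/negP/negPn.
have -> : (h = N.+1 + (h - N.+1))%N by rewrite subnKC.
rewrite expnD (@leq_trans (s.+1 ^ N.+1)) //; last by rewrite leq_pmulr // expn_gt0.
rewrite expnS (@leq_ltn_trans (D.+1 ^ N * s.+1 ^ N)) //.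
  rewrite -expnMn; have : ((D * s).+1 <= D.+1 * s.+1)%N by lia.
  by move: (D * s).+1 (D.+1 * s.+1)%N => x y xy; case: (N) => // e; rewrite leq_exp2r.
by rewrite ltn_mul2r expn_gt0 /= ltnS.
Qed.

End Dimension.

Section CoordinatePrimes.
Variables (k : fieldType) (N : nat).
Notation R := {mpoly k[N]}.
Implicit Types (S : {set 'I_N}).

Definition coord_ideal S : R -> Prop := mon_ideal (wge S 1).

(** It is the kernel of the substitution that sends the variables of [S] to 0. *)
Lemma coord_ideal_prime S : is_prime (coord_ideal S).
Proof.
pose A : 'M[k]_N := diag_mx (\row_i (i \notin S)%:R).
have AX i : linsub A 'X_i = (i \notin S)%:R *: 'X_i.
  rewrite linsubX (bigD1 i) //= !mxE eqxx mulr1n big1 ?addr0 // => j ji.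
  by rewrite !mxE (negPf ji) mulr0n scale0r.
have Am m : linsub A 'X_[m] = (~~ wge S 1 m)%:R *: 'X_[m].
  rewrite mpolyXE_id rmorph_prod /=.
  under eq_bigr => i _ do rewrite rmorphXn /= AX exprZn.
  rewrite scaler_prod; congr (_ *: _).
  rewrite /wge -leqNgt leqn0 /wdeg sum_nat_eq0.
  case: forall_inP => h; last first.
    have /forall_inPn[j jS mj] : ~~ [forall i in S, m i == 0%N] by apply/forall_inP.
    by rewrite (bigD1 j) //= jS expr0n (negPf mj) mul0r.
  by apply: big1 => i _; case: (boolP (i \in S)) => [/h/eqP ->|_]; rewrite ?expr0 ?expr1n.
have kerA f : coord_ideal S f <-> linsub A f = 0.
  have Af : linsub A f = \sum_(m <- msupp f | ~~ wge S 1 m) f@_m *: 'X_[m].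
    rewrite {1}[f]mpolyE (raddf_sum (linsub A)) [RHS]big_mkcond; apply: eq_bigr => m _ /=.
    by rewrite linearZ /= Am; case: ifP; rewrite ?scale1r ?scale0r ?scaler0.
  split=> [/allP h|A0]; first by rewrite Af big_seq_cond big1 // => m /andP[/h ->].
  apply/allP => m mf; apply/negPn/negP => nm; move: (mf); rewrite mcoeff_msupp.
  have := congr1 (mcoeff m) A0; rewrite Af mcoeff0 raddf_sum -big_filter.
  rewrite (bigD1_seq m) ?filter_uniq ?msupp_uniq ?mem_filter ?nm ?mf //=.
  rewrite big1 ?addr0 => [|m' ne]; rewrite mcoeffZ mcoeffX; last by rewrite (negPf ne) mulr0.
  by rewrite eqxx mulr1 => ->; rewrite eqxx.
split.
- exact: mon_ideal_ideal (@wge_up _ _ _).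
- by move/kerA; rewrite rmorph1 => /eqP; rewrite oner_eq0.
move=> f g /kerA; rewrite rmorphM => /eqP; rewrite mulf_eq0.
by case/orP => /eqP /kerA; [left|right].
Qed.

Lemma coord_idealX S i : coord_ideal S 'X_i <-> i \in S.
Proof. by rewrite /coord_ideal mon_idealX /wge wdegU lt0b. Qed.

Lemma coord_idealS S S' : S \subset S' -> ideal_le (coord_ideal S) (coord_ideal S').
Proof.
move=> SS' f /allP h; apply/allP => m /h; rewrite /wge => w; apply: leq_trans w _.
by rewrite /wdeg [leqRHS](big_setID S) /= (setIidPr SS') leq_addr.
Qed.

Lemma coord_ideal_min S (J : R -> Prop) : is_ideal J -> (forall i, i \in S -> J 'X_i) ->
  ideal_le (coord_ideal S) J.
Proof.
move=> iJ JX; apply: (mon_ideal_min iJ) => m hm.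
have [j jS mj] : exists2 j, j \in S & (0 < m j)%N.
  apply/exists_inP; apply: contraLR hm => /exists_inPn nz.
  rewrite /wge /wdeg big1 // => j /nz; by rewrite -eqn0Ngt => /eqP.
have <- : ((m - U_(j)) + U_(j))%MM = m by rewrite submK // lep1mP -lt0n.
by rewrite mpolyXD; case: iJ => _ _; apply; apply: JX.
Qed.

End CoordinatePrimes.

Section Codimension.
Variables (k : fieldType) (n : nat).
Notation R := {mpoly k[n.+1]}.

(** The ideals generated by the first variables different from X_l lie below [P], which takes
the place of the last one. *)
Lemma prime_chain_coord (P : R -> Prop) l : is_prime P ->
  (forall j, j != l -> P 'X_j) -> prime_chain P n.
Proof.
move=> pP PX; have [iP _ _] := pP.
have PXl j : P 'X_(lift l j) by apply: PX; rewrite eq_sym neq_lift.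
pose S i := [set lift l j | j : 'I_n & (j < i)%N].
exists (fun i => if (i < n)%N then (coord_ideal (S i) : R -> Prop) else P); split.
- by move=> i _; case: ifP => // _; apply: coord_ideal_prime.
- move=> i lt; rewrite lt.
  have inS j i' : (lift l j \in S i') = (j < i')%N.
    apply/imsetP/idP => [[j' /[!inE] h /lift_inj -> //]|h]; by exists j; rewrite ?inE.
  case: ifP => lt'.
    split; first by apply: coord_idealS; apply: imsetS; apply/subsetP => j; rewrite !inE => /ltnW.
    move=> /(_ 'X_(lift l (Ordinal lt))).
    by rewrite !coord_idealX !inS /= ltnn ltnSn => /(_ isT).
  split; first by apply: (coord_ideal_min iP) => _ /imsetP[j _ ->]; apply: PXl.
  move=> /(_ 'X_(lift l (Ordinal lt))); rewrite coord_idealX inS /= ltnn.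
  by move=> h; have := h (PXl _).
by move=> f; rewrite ltnn.
Qed.

(** A chain below the ideal of a point can be extended by the irrelevant ideal, so its length
is less than the bound n + 1 on all chains. *)
Lemma coord_height l : prime_height (coord_ideal [set~ l] : R -> Prop) n.
Proof.
split.
  apply: (@prime_chain_coord _ l); first exact: coord_ideal_prime.
  by move=> j jl; apply/coord_idealX; rewrite !inE.
move=> h [Q [Qp Qs QP]]; rewrite -ltnS.
apply: (@chain_length_le k _ ((coord_ideal setT : R -> Prop))).
exists (fun i => if (i <= h)%N then Q i else (coord_ideal setT : R -> Prop)); split.
- by move=> i _; case: ifP => [/Qp //|_]; apply: coord_ideal_prime.
- move=> i; rewrite ltnS => ih; rewrite ih; have [lt|ge] := ltnP i h; first exact: Qs.
  have {ih ge}-> : i = h by apply/eqP; rewrite eqn_leq ih.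
  split=> [f /QP|le]; first by apply: coord_idealS; apply: subsetT.
  have /le/QP/coord_idealX : coord_ideal setT ('X_l : R) by apply/coord_idealX; rewrite inE.
  by rewrite !inE eqxx.
by move=> f; rewrite ltnn.
Qed.

(** Otherwise, for each [l] some variable other than X_l is outside [P]; the product of the
[a l]-th powers of these variables is in the ideal but not in [P]. *)
Lemma prime_over_fat (P : R -> Prop) (a : 'I_n.+1 -> nat) : is_prime P -> ideal_le (mon_ideal (fat_mon a)) P ->
  exists l, forall j, j != l -> P 'X_j.
Proof.
move=> pP IP; apply: NNPP => nex.
have [l|j hj] := @fin_skolem _ _ (fun l j : 'I_n.+1 => j != l /\ ~ P 'X_j).
  have := not_ex_all_not _ _ nex l => nl; have [j nj] := not_all_ex_not _ _ nl.
  by exists j; apply: imply_to_and.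
pose M : 'X_{1..n.+1} := (\sum_l U_(j l) *+ a l)%MM.
have : P 'X_[M].
  apply: IP; apply/mon_idealX; apply/fat_mon_wge => l.
  rewrite /wge (@leq_trans (wdeg [set~ l] (U_(j l) *+ a l)%MM)) //.
    have wX e m : wdeg [set~ l] (m *+ e)%MM = (wdeg [set~ l] m * e)%N.
      by rewrite /wdeg big_distrl; apply: eq_bigr => i _; rewrite mulmnE.
    by rewrite wX wdegU !inE (hj l).1 mul1n.
  by rewrite /M (bigD1 l) //= wdegD leq_addr.
have [_ P1 PM] := pP.
suff : ~ P 'X_[M] by [].
rewrite /M -mprodXE; elim/big_rec: _ => [//|l x _ Px] /PM[]//.
by rewrite -mpolyXn; apply: primeX_notin pP (hj l).2.
Qed.

Lemma fat_codim (a : 'I_n.+1 -> nat) c : (0 < a ord0)%N -> codimension (mon_ideal (k := k) (fat_mon a)) c -> c = n.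
Proof.
move=> a0 [[P [pP IP [Pc Pmax]]] cmin]; apply/eqP; rewrite eqn_leq; apply/andP; split.
  apply: (cmin (coord_ideal [set~ ord0])) (coord_height ord0).
    exact: coord_ideal_prime.
  move=> f /allP h; apply/allP => m /h /fat_mon_wge/(_ ord0); exact: leq_trans.
have [l PX] := prime_over_fat pP IP.
exact: Pmax (prime_chain_coord pP PX).
Qed.

End Codimension.

(** * Counting monomials *)

Section Counting.
Local Open Scope nat_scope.
Variable N : nat.
Notation mon := 'X_{1..N}.
Implicit Types (J : {set 'I_N}) (l : 'I_N).

Definition monos b : seq mon := [seq val m | m <- enum {: 'X_{1..N < b}}].

Lemma mem_monos b m : (m \in monos b) = (mdeg m < b).
Proof.
apply/mapP/idP => [[m' _ ->]|lt]; first exact: bmdeg.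
by exists (BMultinom lt); rewrite ?mem_enum.
Qed.

Lemma monos_uniq b : uniq (monos b).
Proof. by rewrite map_inj_uniq ?enum_uniq //; apply: val_inj. Qed.

Definition monos_of_degree d := [seq m <- monos d.+1 | mdeg m == d].

Lemma mem_monos_of_degree d m : (m \in monos_of_degree d) = (mdeg m == d).
Proof. by rewrite mem_filter mem_monos ltnS; case: eqP => // ->; rewrite leqnn. Qed.

Lemma monos_of_degree_uniq d : uniq (monos_of_degree d).
Proof. by rewrite filter_uniq // monos_uniq. Qed.

Lemma count_monosS (P : pred mon) b :
  count P (monos b.+1) = count P (monos b) + count P (monos_of_degree b).
Proof.
rewrite -count_cat; apply/permP/uniq_perm; rewrite ?monos_uniq //.
  rewrite cat_uniq monos_uniq monos_of_degree_uniq andbT; apply/hasPn => m.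
  by rewrite mem_monos_of_degree mem_monos => /eqP ->; rewrite ltnn.
by move=> m; rewrite mem_cat mem_monos_of_degree !mem_monos ltnS leq_eqVlt orbC.
Qed.

Definition supp_in J (m : mon) := [forall i, (i \notin J) ==> (m i == 0)].

(** On monomials of a fixed degree the exponent of X_l is determined by the others, so these
conditions amount to a degree bound in the variables of [J] alone. *)
Definition dehomog_pred J l d : pred mon := fun m => supp_in (l |: J) m && (wdeg J m <= d).

Section Dehomogenize.
Variables (J : {set 'I_N}) (l : 'I_N) (d t : nat).
Hypothesis lJ : l \notin J.

Let T := [set u : #|J|.-tuple 'I_d.+1 | \sum_(i <- u) i <= d].

Let coords (m : mon) : #|J|.-tuple 'I_d.+1 := [tuple inord (m (enum_val i)) | i < #|J|].

Let spread (u : #|J|.-tuple 'I_d.+1) : mon :=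
  [multinom if i == l then t - \sum_(i <- u) i else nth 0 (map val u) (index i (enum J)) | i < N].

Lemma wdeg_enum (m : mon) : wdeg J m = \sum_(i < #|J|) m (enum_val i).
Proof. by rewrite /wdeg big_enum_val. Qed.

Lemma supp_deg (m : mon) : supp_in (l |: J) m -> mdeg m = m l + wdeg J m.
Proof.
move=> /forallP h; rewrite mdegE (bigD1 l) //=; congr (_ + _).
rewrite (bigID (fun i => i \in J)) /= [X in _ + X]big1 ?addn0 => [|i /andP[il iJ]].
  by apply: eq_bigl => i; case: eqP => [->|]; rewrite ?(negPf lJ).
by have := h i; rewrite !inE (negPf il) (negPf iJ) => /eqP.
Qed.

Lemma count_dehomog_le : count (dehomog_pred J l d) (monos_of_degree t) <= 'C(#|J| + d, #|J|).
Proof.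
rewrite -card_partial_ord_partitions -size_filter cardE -(size_map coords).
have coordE m i : wdeg J m <= d -> tnth (coords m) i = m (enum_val i) :> nat.
  move=> le; rewrite tnth_mktuple inordK // ltnS (leq_trans _ le) // wdeg_enum.
  by rewrite (bigD1 i) //= leq_addr.
apply: uniq_leq_size.
  rewrite map_inj_in_uniq ?(filter_uniq _ (monos_of_degree_uniq _)) //.
  move=> m m'; rewrite !(mem_filter (dehomog_pred J l d)) !mem_monos_of_degree.
  case/andP=> /andP[sm wm] /eqP dm /andP[/andP[sm' wm'] /eqP dm'] e.
  have eJ i : i \in J -> m i = m' i.
    move=> iJ; rewrite -(enum_rankK_in iJ iJ) -(coordE m) // -(coordE m') //.
    by rewrite e.
  have eW : wdeg J m = wdeg J m' by apply: eq_bigr.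
  apply/mnmP => i; case: (boolP (i \in J)) => [/eJ //|iJ].
  have [->|il] := eqVneq i l.
    by apply/eqP; rewrite -(eqn_add2r (wdeg J m)) {2}eW -!supp_deg // dm dm'.
  have /forallP/(_ i) := sm; have /forallP/(_ i) := sm'.
  by rewrite !inE (negPf il) (negPf iJ) => /eqP -> /eqP ->.
move=> _ /mapP[m + ->]; rewrite (mem_filter (dehomog_pred J l d)) => /andP[/andP[sm wm] _].
rewrite mem_enum inE big_tuple (leq_trans _ wm) // wdeg_enum leq_sum // => i _.
by rewrite coordE.
Qed.

Lemma count_dehomog : d <= t -> count (dehomog_pred J l d) (monos_of_degree t) = 'C(#|J| + d, #|J|).
Proof.
move=> dt; apply/eqP; rewrite eqn_leq count_dehomog_le /=.
rewrite -card_partial_ord_partitions -size_filter cardE -(size_map spread).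
have spreadJ u i : spread u (enum_val i) = tnth u i.
  rewrite mnmE; case: eqP => [e|_]; first by move: lJ; rewrite -e enum_valP.
  rewrite (enum_val_nth (enum_default i)) index_uniq ?enum_uniq //; last by rewrite -cardE.
  by rewrite (nth_map (tnth u i)) ?size_tuple // -tnth_nth.
have wspread u : wdeg J (spread u) = \sum_(i <- u) i.
  by rewrite wdeg_enum big_tuple; apply: eq_bigr => i _; rewrite spreadJ.
have sspread u : supp_in (l |: J) (spread u).
  apply/forallP => i; apply/implyP; rewrite !inE negb_or => /andP[il iJ].
  rewrite mnmE (negPf il) nth_default // size_map size_tuple cardE leqNgt index_mem.
  by rewrite mem_enum.
apply: uniq_leq_size.
  rewrite map_inj_in_uniq ?enum_uniq // => u u' _ _ e.
  by apply: eq_from_tnth => i; apply/val_inj; rewrite /= -!spreadJ e.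
move=> _ /mapP[u + ->]; rewrite mem_enum inE => su.
rewrite (mem_filter (dehomog_pred J l d)) mem_monos_of_degree /dehomog_pred sspread wspread su supp_deg //=.
by rewrite wspread mnmE eqxx subnK // (leq_trans su).
Qed.

End Dehomogenize.

Variable a : 'I_N -> nat.

(** The multiplicity of a point of multiplicity [b]: the number of monomials of degree less
than [b] in [n] variables. *)
Definition point_mult n b := if b is d.+1 then 'C(n + d, n) else 0.

Let offpoint l : pred mon := fun m => wdeg [set~ l] m < a l.

Lemma fat_monN m : ~~ fat_mon a m = [exists l, offpoint l m].
Proof.
rewrite negb_forall; apply: eq_existsb => l.
by rewrite -(wdegC1 l) leq_add2l /offpoint ltnNge.
Qed.

Lemma cardsC1_ord l : #|[set~ l]| = N.-1.
Proof. by rewrite cardsC1 card_ord. Qed.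

Lemma supp_in_all l m : supp_in (l |: [set~ l]) m.
Proof. by apply/forallP => i; rewrite !inE; case: eqP. Qed.

Lemma count_offpoint_le l t : count (offpoint l) (monos_of_degree t) <= point_mult N.-1 (a l).
Proof.
rewrite /offpoint; case: (a l) => [|d]; first by rewrite /= count_pred0.
have lJ : l \notin [set~ l] by rewrite setC11.
rewrite /point_mult -(cardsC1_ord l); apply: leq_trans (count_dehomog_le d t lJ).
by apply: sub_count => m; rewrite ltnS /dehomog_pred supp_in_all.
Qed.

Lemma count_offpoint l t : a l <= t -> count (offpoint l) (monos_of_degree t) = point_mult N.-1 (a l).
Proof.
rewrite /offpoint; case: (a l) => [|d] dt; first by rewrite /= count_pred0.
rewrite /point_mult -(cardsC1_ord l) -(@count_dehomog [set~ l] l d t) ?setC11 ?(ltnW dt) //.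
by apply: eq_count => m; rewrite ltnS /dehomog_pred supp_in_all.
Qed.

Lemma sum_count (I : finType) (P : I -> pred mon) s :
  \sum_i count (P i) s = \sum_(m <- s) \sum_i (P i m : nat).
Proof.
rewrite exchange_big /=; apply: eq_bigr => i _.
by rewrite -sum1_count [LHS]big_mkcond; apply: eq_bigr => m _; case: (P i m).
Qed.

Lemma count_standard_le t :
  count (predC (fat_mon a)) (monos_of_degree t) <= \sum_l point_mult N.-1 (a l).
Proof.
apply: (@leq_trans (\sum_l count (offpoint l) (monos_of_degree t))); last first.
  by apply: leq_sum => l _; apply: count_offpoint_le.
rewrite sum_count -sum1_count big_mkcond; apply: leq_sum => m _ /=.
rewrite fat_monN; case: existsP => [[l hl]|_] //=.
by rewrite (bigD1 l) //= hl.
Qed.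

(** In large degree no monomial violates two of the conditions. *)
Lemma count_standard t : \sum_l a l <= t ->
  count (predC (fat_mon a)) (monos_of_degree t) = \sum_l point_mult N.-1 (a l).
Proof.
move=> at_; have le l : a l <= t by rewrite (leq_trans _ at_) // (bigD1 l) //= leq_addr.
rewrite -(eq_bigr _ (fun l _ => count_offpoint (le l))) sum_count -sum1_count big_mkcond.
apply: eq_big_seq => m; rewrite mem_monos_of_degree => /eqP dm /=.
rewrite fat_monN; case: existsP => [[l hl]|nex] /=; last first.
  by rewrite big1 // => l _; case: (boolP (offpoint l m)) => // hl; case: nex; exists l.
rewrite (bigD1 l) //= hl big1 ?addn0 // => l' ne; apply/eqP; rewrite eqb0; apply/negP => hl'.
have : m l' <= wdeg [set~ l] m by rewrite /wdeg (bigD1 l') ?inE //= leq_addr.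
have := wdegC1 l' m; move: hl hl'; rewrite /offpoint dm.
have : a l + a l' <= t.
  by rewrite (leq_trans _ at_) // (bigD1 l) //= (bigD1 l') //= leq_add2l leq_addr.
lia.
Qed.

End Counting.

(** * Multiplicity of fat points *)

Section FatCounts.
Local Open Scope nat_scope.

Lemma count_sub_in (T : eqType) (p q : pred T) s :
  {in s, forall x, p x -> q x} -> count p s <= count q s.
Proof.
move=> pq; rewrite (@eq_in_count _ _ (predI p q)) => [|x xs /=].
  by apply: sub_count => x /andP[].
by case px : (p x) => //=; rewrite pq.
Qed.

Lemma card_monos_of_degree n d : size (monos_of_degree n.+1 d) = 'C(n + d, n).
Proof.
have lJ : ord0 \notin [set~ (ord0 : 'I_n.+1)] by rewrite setC11.
rewrite -[n in RHS]/(n.+1.-1) -(cardsC1_ord (ord0 : 'I_n.+1)) -(count_dehomog lJ (leqnn d)).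
rewrite -count_predT; apply: eq_in_count => m; rewrite mem_monos_of_degree => /eqP dm.
by rewrite /dehomog_pred supp_in_all -dm -(wdegC1 ord0) leq_addl.
Qed.

Variables (N : nat) (a : 'I_N -> nat) (d : nat).

Lemma count_fat_small j0 : a j0 < d ->
  let q := #|[set l | a l < d]| in
  count (fat_mon a) (monos_of_degree N d) <= 'C(q.-1 + d, q.-1).
Proof.
move=> aj0; set J := [set l | a l < d]; cbv zeta.
have j0J : j0 \in J by rewrite inE.
have lJ : j0 \notin J :\ j0 by rewrite setD11.
have cJ : #|J :\ j0| = #|J|.-1 by rewrite (cardsD1 j0 J) j0J.
rewrite -cJ; apply: leq_trans (count_dehomog_le d d lJ).
apply: count_sub_in => m; rewrite mem_monos_of_degree => /eqP dm /forallP fm.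
rewrite /dehomog_pred setD1K // -[X in _ <= X]dm -wdegT; apply/andP; split.
  apply/forallP => i; apply/implyP; rewrite inE -leqNgt => ai.
  by have := fm i; rewrite dm; move: ai; lia.
by rewrite /wdeg [leqRHS](big_setID (J :\ j0)) /= setTI leq_addr.
Qed.

Lemma card_below (f : 'I_N -> nat) : (forall l, f l <= d) ->
  #|[set u : 'I_N * 'I_d | u.2 < f u.1]| = \sum_l f l.
Proof.
move=> fd; rewrite -sum1_card (eq_bigl (fun u : 'I_N * 'I_d => true && (u.2 < f u.1))); last first.
  by move=> u; rewrite inE.
rewrite -(pair_big_dep xpredT (fun l (j : 'I_d) => j < f l) (fun _ _ => 1)) /=.
apply: eq_bigr => l _; rewrite sum1_card -[RHS]card_ord.
have inj : injective (widen_ord (fd l)) by move=> i j /(congr1 val) /= /val_inj.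
rewrite -(card_image inj).
apply: eq_card => j; rewrite [LHS]inE; apply/idP/imageP => [lt|[i _ ->]]; last exact: (ltn_ord i).
by exists (Ordinal lt) => //; apply: val_inj.
Qed.

(** Exponents are at most [d - a l], so such a monomial is a sub-multiset of size [d] of a
fixed multiset, and it is the image of a subset of size [d]. *)
Lemma count_fat_multiset :
  (forall l, a l <= d) ->
  count (fat_mon a) (monos_of_degree N d) <= 'C(\sum_l (d - a l), d).
Proof.
move=> ad; rewrite -(card_below (f := fun l => d - a l)); last by move=> l; apply: leq_subr.
set W := [set u | _]; rewrite -cards_draws cardE -size_filter.
pose young (m : 'X_{1..N}) : {set 'I_N * 'I_d} := [set u : 'I_N * 'I_d | u.2 < m u.1].
rewrite -(size_map young); apply: uniq_leq_size.
  rewrite map_inj_in_uniq ?(filter_uniq _ (monos_of_degree_uniq _ _)) //.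
  move=> m m'; rewrite !(mem_filter (fat_mon a)) !mem_monos_of_degree.
  case/andP=> _ /eqP dm /andP[_ /eqP dm'] /setP e.
  have le (x y : 'X_{1..N}) : mdeg x = d -> young x =i young y -> forall l, x l <= y l.
    move=> dx exy l; rewrite leqNgt; apply/negP => lt.
    have ly : y l < d by rewrite (leq_trans lt) // -dx mdegE (bigD1 l) //= leq_addr.
    by have := exy (l, Ordinal ly); rewrite !inE /= lt ltnn.
  apply/mnmP => l; apply/eqP; rewrite eqn_leq (le m m') //=.
  by rewrite (le m' m) // => u; rewrite e.
move=> _ /mapP[m + ->]; rewrite (mem_filter (fat_mon a)) mem_monos_of_degree.
move=> /andP[/forallP fm /eqP dm]; rewrite mem_enum inE; apply/andP; split.
  apply/subsetP => u; rewrite !inE => lt; rewrite (leq_trans lt) //.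
  by rewrite leq_subRL ?ad // addnC -[X in _ <= X]dm; apply: fm.
rewrite card_below -?mdegE ?dm // => l.
by rewrite -dm mdegE (bigD1 l) //= leq_addr.
Qed.

End FatCounts.

Section Multiplicity.
Variables (k : fieldType) (N : nat).
Notation R := {mpoly k[N]}.

(** The given basis has the cardinal of the basis formed by the standard monomials. *)
Lemma quot_dim_monomial (P : pred 'X_{1..N}) t h :
  up_closed P ->
  quot_dim (ideal_add (mon_ideal P) (ideal_pow (@irrelevant k N) t)) h ->
  h = count (predC P) (monos N t).
Proof.
move=> upP; set s := filter (predC P) (monos N t).
have addE f : ideal_add (mon_ideal P) (ideal_pow (@irrelevant k N) t) f <->
    forall m, m \in s -> f@_m = 0.
  have powE g := ideal_pow_wge (@irrelevant_wge k N) t g.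
  split=> [[g [h' [/allP hg /powE/allP hh ->]]] m|h0].
    rewrite mem_filter mem_monos => /andP[/= nP lt]; rewrite mcoeffD !memN_msupp_eq0 ?addr0 //.
      by apply/negP => /hh; rewrite /wge wdegT leqNgt lt.
    by apply/negP => /hg; apply/negP.
  have iI : is_ideal (mon_ideal P : R -> Prop) by apply: mon_ideal_ideal.
  have iP : is_ideal (mon_ideal (wge setT t) : R -> Prop).
    by apply: mon_ideal_ideal; apply: wge_up.
  exists (\sum_(m <- msupp f | P m) f@_m *: 'X_[m]), (\sum_(m <- msupp f | ~~ P m) f@_m *: 'X_[m]).
  have scal (J : R -> Prop) c g : is_ideal J -> J g -> J (c *: g).
    by move=> [_ _ JM] Jg; rewrite -mul_mpolyC; apply: JM.
  split; last by rewrite {1}[f]mpolyE (bigID P).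
  - rewrite -big_filter; apply: ideal_sum => // m; rewrite mem_filter => /andP[Pm _].
    by apply: scal => //; apply/mon_idealX.
  - apply/powE; rewrite -big_filter; apply: ideal_sum => // m.
    rewrite mem_filter => /andP[Pm mf]; apply: scal => //; apply/mon_idealX.
    rewrite /wge wdegT leqNgt; apply: contraL mf => lt.
    by rewrite -mcoeff_eq0 h0 // mem_filter mem_monos lt /= Pm.
move=> [b [gen free]]; rewrite -size_filter -/s; apply/eqP; rewrite eqn_leq; apply/andP; split.
  apply: (@independent_le k N _ _ b (tnth (in_tuple s))) => c hc.
  apply: free; apply/addE => m /(tnthP (in_tuple s))[j ->]; exact: hc.
apply: (@spanning_ge k N _ _ b (tnth (in_tuple s))).
  by apply/tuple_uniqP; rewrite /= filter_uniq // monos_uniq.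
move=> j; have [c /addE hc] := gen 'X_[tnth (in_tuple s) j]; exists c => j'.
by apply: hc; apply: (mem_tnth j' (in_tuple s)).
Qed.

Lemma poly_agree_nat (p q : {poly rat}) t0 :
  (forall t, (t0 <= t)%N -> p.[t%:R] = q.[t%:R]) -> p = q.
Proof.
move=> e; apply/eqP; rewrite -subr_eq0; apply/negPn/negP => nz.
pose rs := [seq (t0 + i)%:R : rat | i <- iota 0 (size (p - q))].
have := @max_poly_roots _ _ rs nz; rewrite size_map size_iota ltnn => h; suff: false by []; apply: h.
  apply/allP => _ /mapP[i _ ->]; rewrite /root hornerD hornerN e ?leq_addr //.
  by rewrite subrr.
rewrite map_inj_uniq ?iota_uniq // => i j /eqP; rewrite eqr_nat eqn_add2l.
by move/eqP.
Qed.

(** The Hilbert-Samuel function is eventually affine of slope [E], hence so is the polynomial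
that agrees with it. *)
Lemma multiplicity_monomial (P : pred 'X_{1..N}) T E e :
  up_closed P -> (0 < E)%N ->
  (forall t, (T <= t)%N -> count (predC P) (monos_of_degree N t) = E) ->
  multiplicity (mon_ideal (k := k) P) e -> e = E%:R.
Proof.
move=> upP E0 hE [Q [t0 hQ] ->]; set M := maxn t0 T.
have Qt t : (t0 <= t)%N -> Q.[t%:R] = (count (predC P) (monos N t.+1))%:R.
  by move=> /hQ[h /(quot_dim_monomial upP) ->].
pose c : rat := Q.[M%:R] - (E * M)%:R.
have Qlin i : Q.[(M + i)%:R] = Q.[M%:R] + (E * i)%:R.
  elim: i => [|i IHi]; first by rewrite addn0 muln0 addr0.
  have leM j : (t0 <= M + j)%N by rewrite (leq_trans (leq_maxl t0 T)) // leq_addr.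
  have leT j : (T <= M + j)%N by rewrite (leq_trans (leq_maxr t0 T)) // leq_addr.
  rewrite Qt // count_monosS hE // natrD addnS -Qt // IHi.
  by rewrite mulnSr natrD addrA.
have -> : Q = E%:R *: 'X + c%:P.
  apply: (@poly_agree_nat _ _ M) => t /subnKC <-; rewrite Qlin hornerD hornerZ hornerX hornerC.
  by rewrite /c !natrM natrD; ring.
have E0' : E%:R != 0 :> rat by rewrite pnatr_eq0 -lt0n.
have sE : size (E%:R *: 'X : {poly rat}) = 2%N by rewrite size_scale // size_polyX.
have lt : (size c%:P < size (E%:R *: 'X : {poly rat}))%N.
  by rewrite sE (leq_ltn_trans (size_polyC_leq1 _)).
by rewrite size_polyDl // lead_coefDl // sE lead_coefZ lead_coefX mulr1 mul1r.
Qed.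

End Multiplicity.

(** * Degrees of the syzygies of fat points *)

Section Numerics.
Local Open Scope nat_scope.

Lemma point_multS n b : point_mult n.+1 b.+1 = point_mult n.+1 b + point_mult n b.+1.
Proof. by case: b => [|b]; rewrite /point_mult ?addn0 ?binn // addnS binS addnS addSn. Qed.

Lemma leq_point_mult n b b' : b <= b' -> point_mult n b <= point_mult n b'.
Proof.
case: b b' => [//|b] [//|b'] le; rewrite /point_mult.
by apply: leq_bin2l; rewrite leq_add2l.
Qed.

(** By Pascal's rule, induction on [n] and [y]. With x and y the two largest multiplicities,
the left-hand side bounds the sum of the multiplicities of n + 1 points. *)
Lemma point_mult_add n x y : y <= x ->
  point_mult n x + n * point_mult n y <= point_mult n (x + y).
Proof.
elim: n x y => [|n IHn] x y.
  by move=> _; rewrite mul0n addn0 leq_point_mult ?leq_addr.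
elim: y => [|y IHy] yx; first by rewrite muln0 !addn0.
rewrite addnS [leqRHS]point_multS point_multS mulnDr addnA.
apply: leq_add; first exact: IHy (ltnW yx).
rewrite -addnS mulSn (leq_trans _ (IHn _ _ yx)) // leq_add2r.
exact: leq_point_mult.
Qed.

Lemma prod_risingS b n : \prod_(i < n) (b.+1 + i) = n`! * 'C(n + b, n).
Proof.
rewrite mulnC bin_ffact ffact_prod [RHS](reindex_inj rev_ord_inj) /=.
by apply: eq_bigr => i _; move: (nat_of_ord i) (ltn_ord i) => j ji; lia.
Qed.

Lemma prod_shift b n : (\prod_(i < n) (b + i)) * (b + n) = b * \prod_(i < n) (b.+1 + i).
Proof.
elim: n => [|n IHn]; first by rewrite !big_ord0 addn0 mul1n muln1.
by rewrite !big_ord_recr /= IHn addSnnS mulnA.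
Qed.

(** With B = C(n + alpha, n), the product telescopes to n! B alpha / (alpha + q), and
C(q - 1 + alpha, q - 1) = C(q + alpha, q) q / (alpha + q) is at most B q / (alpha + q). *)
Lemma prod_two_strands alpha q n E : q <= n -> 0 < alpha -> 0 < q ->
  'C(n + alpha, n) <= E + 'C(q.-1 + alpha, q.-1) ->
  \prod_(i < n) (if i < q then alpha + i else alpha.+1 + i) <= n`! * E.
Proof.
move=> qn a0 q0 hE; set P := \prod_(i < n) _.
have PE : P * (alpha + q) = alpha * (n`! * 'C(n + alpha, n)).
  rewrite -prod_risingS /P -(subnKC qn) !big_split_ord /= mulnAC.
  under eq_bigr => i _ do rewrite ltn_ord.
  rewrite prod_shift -mulnA; congr (_ * (_ * _)); apply: eq_bigr => i _.
  by rewrite ltnNge leq_addr.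
have binq : (alpha + q) * 'C(q.-1 + alpha, q.-1) <= q * 'C(n + alpha, n).
  have -> : q.-1 + alpha = (alpha + q).-1 by lia.
  rewrite mul_bin_diag prednK // leq_mul2l.
  rewrite -(bin_sub (leq_addl alpha q)) -(bin_sub (leq_addr alpha n)) addKn addnK addnC.
  by rewrite leq_bin2l ?orbT // leq_add2r.
have aq : 0 < alpha + q by rewrite addn_gt0 a0.
rewrite -(leq_pmul2r aq) PE.
rewrite mulnCA -mulnA leq_pmul2l ?fact_gt0 //.
have : (alpha + q) * 'C(n + alpha, n) <= (alpha + q) * (E + 'C(q.-1 + alpha, q.-1)).
  by rewrite leq_mul2l hE orbT.
rewrite mulnDr mulnDl; move: binq.
rewrite [E * _]mulnC; move: (_ * E) (_ * 'C(_.-1 + _, _)) (alpha * _) (q * _) => u v w z; lia.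
Qed.

Lemma fill N (lo hi : 'I_N -> nat) s :
  (forall l, lo l <= hi l) -> \sum_l lo l <= s -> s <= \sum_l hi l ->
  exists m : 'X_{1..N}, [/\ forall l, lo l <= m l, forall l, m l <= hi l & mdeg m = s].
Proof.
move=> lohi; elim: s => [|s IHs] los shi.
  exists [multinom lo i | i < N]; split=> [l|l|]; rewrite ?mnmE //.
  by rewrite mdegE; apply/eqP; rewrite -leqn0 (eq_bigr lo) // => i _; rewrite mnmE.
move: los; rewrite leq_eqVlt => /orP[/eqP e|lt].
  exists [multinom lo i | i < N]; split=> [l|l|]; rewrite ?mnmE //.
  by rewrite mdegE -e; apply: eq_bigr => i _; rewrite mnmE.
have [m [lom mhi dm]] := IHs lt (ltnW shi).
have [l ml] : exists l, m l < hi l.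
  apply/existsP; apply: contraLR shi => /existsPn h; rewrite -ltnNge ltnS -dm mdegE.
  by apply: leq_sum => l _; rewrite leqNgt.
exists (m + U_(l))%MM; split=> [i|i|]; last by rewrite mdegD mdeg1 dm addn1.
  by rewrite mnmDE (leq_trans (lom i)) ?leq_addr.
by rewrite mnmDE mnm1E; case: eqP => [<-|_]; rewrite ?addn1 ?addn0.
Qed.

Lemma card_interval N c i : c + i <= N -> #|[set l : 'I_N | c <= l < c + i]| = i.
Proof.
move=> ciN; have lt (j : 'I_i) : c + j < N by rewrite (leq_trans _ ciN) // ltn_add2l.
rewrite -[RHS]card_ord -(card_imset predT (f := fun j : 'I_i => Ordinal (lt j))); last first.
  by move=> j j' /(congr1 val) /= /addnI /val_inj.
apply: eq_card => l; rewrite inE; apply/idP/imsetP => [/andP[cl lci]|[j _ ->]] /=.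
  have h : l - c < i by rewrite ltn_subLR.
  by exists (Ordinal h) => //; apply: val_inj; rewrite /= subnKC.
by rewrite leq_addr ltn_add2l /= ltn_ord.
Qed.

End Numerics.

Section FatBounds.
Local Open Scope nat_scope.
Variables (k : fieldType) (n : nat).
Hypothesis char_k : [pchar k]%R =i pred0.
Notation o0 := (ord0 : 'I_n.+2).
Notation o1 := (lift ord0 ord0 : 'I_n.+2).
Variable a : 'I_n.+2 -> nat.
Hypothesis a_gt0 : 0 < a o0.
Hypothesis a_decr : forall i j : 'I_n.+2, i <= j -> a j <= a i.
Variable F : min_graded_resolution (mon_ideal (k := k) (fat_mon a)).

Let le_a0 l : a l <= a o0. Proof. exact: a_decr. Qed.

Let le_a1 l : l != o0 -> a l <= a o1.
Proof. by move=> l0; apply: a_decr; rewrite lt0n. Qed.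

(** Witnessed by the minimal generator X_0^(a 1) X_1^(a 0), which is tight at both points. *)
Lemma large_syzygy i : i <= n -> a o0 + a o1 + i \in syz_deg F i.+1.
Proof.
move=> ile; pose M : 'X_{1..n.+2} := (U_(o0) *+ a o1 + U_(o1) *+ a o0)%MM.
have ME l : M l = (o0 == l) * a o1 + (o1 == l) * a o0 by rewrite mnmDE !mulmnE !mnm1E.
have dM : mdeg M = a o0 + a o1 by rewrite mdegD !mdegMn !mdeg1 !mul1n addnC.
have ci : #|[set l : 'I_n.+2 | 2 <= l < 2 + i]| = i by apply: card_interval.
rewrite -dM -{1 2}ci; apply: (@fat_syzygy _ k char_k a F M _ o1 o0) => //.
- by rewrite ME eqxx mul1n addnC ltn_addr.
- by rewrite ME dM eqxx mul1n.
- by rewrite ME dM eqxx mul1n addn0 addnC.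
- apply/forallP => l; rewrite ME dM.
  have [<-|l0] := eqVneq o0 l; first by rewrite /= mul1n mul0n addn0 addnC.
  have [<-|l1] := eqVneq o1 l; first by rewrite /= mul1n mul0n add0n.
  by rewrite !mul0n add0n (leq_trans (le_a0 l)) // leq_addr.
move=> l; rewrite inE => /andP[l2 _]; rewrite ME dM.
have -> : (o0 == l) = false by apply/negP => /eqP e; rewrite -e in l2.
have -> : (o1 == l) = false by apply/negP => /eqP e; rewrite -e in l2.
by rewrite !mul0n !add0n -[X in X < _]add0n -addSn leq_add // le_a1 //; case: eqP l2 => // ->.
Qed.

Let omax : 'I_n.+2 := ord_max.

Lemma sum_interval (c i : nat) : c + i <= n.+2 -> \sum_(l < n.+2) (c <= l < c + i : nat) = i.
Proof.
move=> h; rewrite -[RHS](card_interval h) -sum1_card [RHS]big_mkcond.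
by apply: eq_bigr => l _; rewrite inE; case: ifP.
Qed.

Lemma sum_pick (l0 : 'I_n.+2) (c : nat) : \sum_(l < n.+2) (l == l0) * c = c.
Proof.
rewrite (bigD1 l0) //= eqxx mul1n big1 ?addn0 // => l ne.
by rewrite (negPf ne).
Qed.

Lemma sum_pick1 (l0 : 'I_n.+2) : \sum_(l < n.+2) (l == l0) = 1.
Proof. by rewrite -[RHS](sum_pick l0 1); apply: eq_bigr => l _; rewrite muln1. Qed.

Section Strands.
Variable alpha : nat.
Hypothesis a_le : forall l, a l <= alpha.

(** Witnessed by a monomial of degree [alpha + 1] that is tight exactly at the first two
points. *)
Lemma next_strand i : alpha < a o0 + a o1 -> alpha <= \sum_l (alpha - a l) -> i <= n ->
  alpha.+1 + i \in syz_deg F i.+1.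
Proof.
move=> aa cap ile.
pose lo (l : 'I_n.+2) := (l == o0) * (alpha.+1 - a o0) + (l == o1) * (alpha.+1 - a o1).
pose hi (l : 'I_n.+2) := (alpha - a l) + (l == o0) + (l == o1).
have [l|||M [loM Mhi dM]] := @fill _ lo hi alpha.+1.
- rewrite /lo /hi; case: (l =P o0) => [->|_] /=.
    by rewrite mul1n !mul0n !addn0 addn1 subSn.
  case: (l =P o1) => [->|_] /=; last by rewrite !mul0n.
  by rewrite mul1n mul0n add0n addn0 addn1 subSn.
- rewrite big_split /= !sum_pick.
  by move: aa (a_le o0) (a_le o1); lia.
- rewrite !big_split /= !sum_pick1; move: cap; move: (\sum_l _) => u; lia.
have M0 : M o0 = alpha.+1 - a o0.
  by apply/eqP; rewrite eqn_leq; move: (loM o0) (Mhi o0) (a_le o0); rewrite /lo /hi /=; lia.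
have M1 : M o1 = alpha.+1 - a o1.
  by apply/eqP; rewrite eqn_leq; move: (loM o1) (Mhi o1) (a_le o1); rewrite /lo /hi /=; lia.
have ci : #|[set l : 'I_n.+2 | 2 <= l < 2 + i]| = i by apply: card_interval.
have a0' := a_le o0; have a1' := a_le o1.
rewrite -dM -{1 2}ci; apply: (@fat_syzygy _ k char_k a F M _ o0 o1) => //.
- by rewrite M0; move: a0'; lia.
- by rewrite M0 dM; move: a0'; lia.
- by rewrite M1 dM; move: a1'; lia.
- apply/forallP => l; have := Mhi l; have := a_le l; rewrite dM /hi.
  case: (l =P o0) => [->|_]; first by rewrite M0; lia.
  case: (l =P o1) => [->|_]; first by rewrite M1; lia.
  by move: (M l) (a l) => u v /=; lia.
move=> l; rewrite inE => /andP[l2 _]; have := Mhi l; have := a_le l; rewrite dM /hi.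
case: (l =P o0) => [e|_]; first by rewrite e in l2.
case: (l =P o1) => [e|_]; first by rewrite e in l2.
by move: (M l) (a l) => u v /=; lia.
Qed.

(** When the first point forces the initial degree, X_0 has exponent 0 and the condition there
is tight. The witness is also tight at the last point and loose at the [i] points before it,
which must have room for that. *)
Lemma first_strand_gap i : a o0 = alpha -> i <= n -> a omax < alpha ->
  (forall l : 'I_n.+2, n.+1 - i <= l -> a l < alpha) -> alpha + i <= \sum_l (alpha - a l) ->
  alpha + i \in syz_deg F i.+1.
Proof.
move=> ea ile amax agap cap; set c := n.+1 - i in agap.
have cE : c + i = n.+1 by rewrite subnK // ltnW.
have ciN : c + i <= n.+2 by rewrite cE.
pose lo (l : 'I_n.+2) := (l == omax) * (alpha - a omax).
pose hi (l : 'I_n.+2) := (alpha - a l) - (c <= l < c + i).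
have gap (l : 'I_n.+2) : (c <= l < c + i : nat) <= alpha - a l.
  by case: andP => // -[/agap]; rewrite subn_gt0.
have omaxN : (c <= omax < c + i) = false by rewrite cE /= ltnn andbF.
have [l|||M [loM Mhi dM]] := @fill _ lo hi alpha.
- rewrite /lo /hi; case: (l =P omax) => [->|_]; last by rewrite mul0n.
  by rewrite omaxN mul1n subn0.
- by rewrite sum_pick leq_subr.
- have : \sum_l (alpha - a l) = \sum_l hi l + i.
    rewrite -[X in _ + X](sum_interval ciN) -big_split /=.
    by apply: eq_bigr => l _; rewrite /hi subnK ?gap.
  by move: cap; move: (\sum_l _) (\sum_l hi l) => u v; lia.
have Mmax : M omax = alpha - a omax.
  apply/eqP; rewrite eqn_leq; move: (loM omax) (Mhi omax); rewrite /lo /hi eqxx mul1n omaxN.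
  by rewrite subn0 => -> ->.
have ci : #|[set l : 'I_n.+2 | c <= l < c + i]| = i by apply: card_interval; rewrite cE.
rewrite -dM -{1 2}ci; apply: (@fat_syzygy _ k char_k a F M _ omax o0) => //.
- by rewrite Mmax subn_gt0.
- by rewrite Mmax dM subnK.
- by have := Mhi o0; rewrite /hi dM ea subnn sub0n leqn0 => /eqP ->.
- apply/forallP => l; have := Mhi l; have := a_le l; rewrite dM /hi.
  by move: (nat_of_bool _) (M l) (a l) => b u v; lia.
move=> l; rewrite inE => /andP[cl lc]; have := Mhi l; rewrite /hi cl lc dM.
by have := agap l cl; move: (M l) (a l) => u v /=; lia.
Qed.

(** When no point forces the initial degree, the witness is as large as possible at all points
but [rho] of them, where one unit is missing; these are the loose ones. *)
Lemma first_strand_tight i rho : (forall l, a l < alpha) -> rho <= n -> i <= rho ->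
  \sum_l (alpha - a l) = alpha + rho -> alpha + i \in syz_deg F i.+1.
Proof.
move=> alt rn ir cap; set c := n.+1 - rho.
have cE : c + rho = n.+1 by rewrite subnK // ltnW.
have crN : c + rho <= n.+2 by rewrite cE.
pose M : 'X_{1..n.+2} := [multinom (alpha - a l) - (c <= l < c + rho) | l < n.+2].
have gap (l : 'I_n.+2) : (c <= l < c + rho : nat) <= alpha - a l.
  by apply: leq_trans (leq_b1 _) _; rewrite subn_gt0.
have dM : mdeg M = alpha.
  apply/eqP; rewrite -(eqn_add2r rho) -cap -{1}(sum_interval crN) mdegE -big_split /=.
  by apply/eqP/eq_bigr => l _; rewrite mnmE subnK.
have omaxN : (c <= omax < c + rho) = false by rewrite cE /= ltnn andbF.
have o0N : (c <= o0 < c + rho) = false by rewrite leqNgt subn_gt0 ltnS rn.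
have ci : #|[set l : 'I_n.+2 | c <= l < c + i]| = i.
  by apply: card_interval; rewrite (leq_trans _ (leqnSn _)) // -cE leq_add2l.
rewrite -dM -{1 2}ci; apply: (@fat_syzygy _ k char_k a F M _ omax o0) => //.
- by rewrite mnmE omaxN subn0 subn_gt0.
- by rewrite mnmE omaxN subn0 dM subnK.
- by rewrite mnmE o0N subn0 dM subnK.
- by apply/forallP => l; rewrite mnmE dM; move: (a l) (nat_of_bool _) (alt l) => v u w; lia.
move=> l; rewrite inE => /andP[cl lc]; rewrite mnmE dM cl (leq_trans lc) ?leq_add2l //=.
by have := alt l; move: (a l) => v; lia.
Qed.

End Strands.

Lemma sum_diff (alpha : nat) : (forall l, a l <= alpha) ->
  \sum_l (alpha - a l) + \sum_l a l = n.+2 * alpha.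
Proof.
move=> ale; rewrite -big_split /= (eq_bigr (fun=> alpha)) => [|l _]; last by rewrite subnK.
by rewrite sum_nat_const card_ord.
Qed.

(** Let rho be the excess of the sum of the largest possible exponents over [alpha]. The linear
strand reaches the step q = min (number of points of multiplicity less than alpha, rho + 1),
and either term bounds the dimension of the ideal in degree [alpha]: the monomials there
involve only the variables of those points, and their complements to the largest exponents
have degree rho. *)
Lemma small_syzygies : exists alpha q, [/\ 0 < alpha, 0 < q <= n.+1,
    forall i, i < q -> alpha + i \in syz_deg F i.+1,
    forall i, q <= i <= n -> alpha.+1 + i \in syz_deg F i.+1
  & count (fat_mon a) (monos_of_degree n.+2 alpha) <= 'C(q.-1 + alpha, q.-1)].
Proof.
have ex : exists alpha, (a o0 <= alpha) && (\sum_l a l <= n.+1 * alpha).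
  exists (\sum_l a l); rewrite (bigD1 o0) //= leq_addr mulSn; exact: leq_addr.
case: (ex_minnP ex) => alpha /andP[a0 cap] amin.
have ale l : a l <= alpha by apply: leq_trans (le_a0 l) a0.
have alpha0 : 0 < alpha by apply: leq_trans a0.
have sumE := sum_diff ale.
set rho := n.+1 * alpha - \sum_l a l.
have capE : \sum_l (alpha - a l) = alpha + rho.
  apply/eqP; rewrite -(eqn_add2r (\sum_l a l)) sumE -addnA subnK //.
set J := [set l | a l < alpha].
have cnt : count (fat_mon a) (monos_of_degree n.+2 alpha) <= 'C(rho + alpha, rho).
  rewrite addnC -(bin_sub (leq_addl _ _)) addnK -capE; exact: count_fat_multiset.
have ltJ l : a l < alpha -> 0 < #|J| by move=> lt; rewrite card_gt0; apply/set0Pn; exists l; rewrite inE.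
have tailJ l : a l = alpha -> #|J| <= n.+1 - l.
  move=> al; have h : l.+1 + (n.+1 - l) <= n.+2 by rewrite addSn subnKC // -ltnS.
  rewrite -(card_interval h); apply: subset_leq_card; apply/subsetP => j; rewrite !inE.
  move=> jl; have lj : l < j by rewrite ltnNge; apply/negP => /a_decr; rewrite al leqNgt jl.
  by rewrite lj addSn subnKC ?ltn_ord // -ltnS.
exists alpha, (minn #|J| rho.+1).
move: a0; rewrite leq_eqVlt => /orP[/eqP e0|lt0].
  have JN : #|J| <= n.+1 by rewrite -[X in _ <= X]subn0; apply: (tailJ o0).
  have amax : a omax < alpha.
    rewrite ltn_neqAle ale andbT; apply/eqP => em.
    have eq_a l : a l = alpha.
      by apply/eqP; rewrite eqn_leq ale -em; apply: a_decr; rewrite -ltnS.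
    move: cap; rewrite (eq_bigr _ (fun l _ => eq_a l)) sum_nat_const card_ord.
    by rewrite leq_mul2r ltnn orbF => /eqP z; rewrite z in alpha0.
  split=> //.
  - by rewrite leq_min (ltJ omax) //= geq_min JN.
  - move=> i; rewrite leq_min ltnS => /andP[iJ ir].
    have iN : i <= n by rewrite -ltnS (leq_trans iJ).
    apply: first_strand_gap => //; last by rewrite capE leq_add2l.
    move=> l il; rewrite ltn_neqAle ale andbT; apply/eqP => /tailJ le.
    by move: (leq_trans iJ le) il iN; lia.
  - move=> i /andP[qi iN]; apply: next_strand => //; last by rewrite capE leq_addr.
    rewrite e0 -[X in X < _]addn0 ltn_add2l lt0n; apply/eqP => a1.
    have z l : l != o0 -> a l = 0 by move=> /le_a1; rewrite a1 leqn0 => /eqP.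
    have eJ : #|J| = n.+1.
      rewrite -[RHS](cardsC1_ord (o0 : 'I_n.+2)); apply: eq_card => l; rewrite !inE.
      by case: (eqVneq l o0) => [->|/z ->] //; rewrite e0 ltnn.
    have sA : \sum_l a l = alpha by rewrite (bigD1 o0) //= big1 ?addn0.
    have rn : n <= rho by rewrite /rho sA mulSn addKn leq_pmulr.
    by move: qi; rewrite eJ geq_min => /orP[]; move: iN rn; lia.
  - rewrite /minn; case: ifP => _; last exact: cnt.
    exact: count_fat_small amax.
have lt l : a l < alpha by apply: leq_ltn_trans lt0; apply: le_a0.
have eJ : #|J| = n.+2.
  by rewrite -[RHS]card_ord; apply: eq_card => l; rewrite !inE lt.
have rn : rho <= n.
  have : ~~ ((a o0 <= alpha.-1) && (\sum_l a l <= n.+1 * alpha.-1)).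
    by apply/negP => /amin; rewrite leqNgt prednK ?leqnn.
  rewrite -ltnS prednK // lt0 /= -ltnNge.
  have -> : n.+1 * alpha.-1 = n.+1 * alpha - n.+1 by rewrite -subn1 mulnBr muln1.
  by rewrite /rho; move: cap; move: (n.+1 * alpha) (\sum_l a l) => u v; lia.
have eq_q : minn #|J| rho.+1 = rho.+1 by rewrite eJ; apply/minn_idPr; rewrite ltnW.
rewrite eq_q; split=> //.
- by move=> i; rewrite ltnS => ir; apply: first_strand_tight capE.
- move=> i /andP[ri iN]; apply: next_strand => //; last by rewrite capE leq_addr.
  rewrite ltnNge; apply/negP => aa.
  have sA : \sum_l a l <= a o0 + n.+1 * a o1.
    rewrite (bigD1 o0) //= leq_add2l -[X in X * _](cardsC1_ord (o0 : 'I_n.+2)) -sum_nat_const.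
    rewrite [leqRHS](eq_bigl (fun l => l != o0)) => [|l]; last by rewrite !inE.
    by apply: leq_sum => l; apply: le_a1.
  have le1 : n.+1 * (a o0 + a o1) <= n.+1 * alpha by rewrite leq_mul2l aa orbT.
  have le2 : n <= n * a o0 by rewrite leq_pmulr.
  have := leq_trans ri iN; move: cap sA le1 le2; rewrite /rho mulnDr mulSn.
  by move: (n * a o0) (n.+1 * a o1) (n.+1 * alpha) (\sum_l a l) (a o0) => x y z u v; lia.
Qed.

Lemma foldr_minn_le (s : seq nat) x d : d \in s -> foldr minn x s <= d.
Proof.
elim: s => //= y s IHs; rewrite inE => /orP[/eqP ->|/IHs h]; first exact: geq_minl.
exact: leq_trans (geq_minr _ _) h.
Qed.

Lemma prod_min_le :
  \prod_(1 <= i < n.+2) min_syz_deg F i <= n.+1`! * \sum_l point_mult n.+1 (a l).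
Proof.
have [alpha [q [al0 /andP[q0 qn] low high cnt]]] := small_syzygies.
apply: leq_trans (prod_two_strands (E := \sum_l point_mult n.+1 (a l)) qn al0 q0 _).
  rewrite big_add1 big_mkord; apply: leq_prod => i _; case: ifP => iq.
    by apply: foldr_minn_le; apply: low.
  by apply: foldr_minn_le; apply: high; rewrite leqNgt iq -ltnS /=.
rewrite -card_monos_of_degree -(count_predC (fat_mon a)) addnC leq_add //.
exact: count_standard_le.
Qed.

Lemma prod_max_ge :
  n.+1`! * \sum_l point_mult n.+1 (a l) <= \prod_(1 <= i < n.+2) max_syz_deg F i.
Proof.
apply: (@leq_trans (n.+1`! * point_mult n.+1 (a o0 + a o1))).
  rewrite leq_mul2l; apply/orP; right.
  apply: leq_trans (point_mult_add n.+1 (le_a0 o1)).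
  rewrite (bigD1 o0) //= leq_add2l -[X in X * _](cardsC1_ord (o0 : 'I_n.+2)) -sum_nat_const.
  rewrite [leqRHS](eq_bigl (fun l => l != o0)) => [|l]; last by rewrite !inE.
  by apply: leq_sum => l /le_a1; apply: leq_point_mult.
have b0 : 0 < a o0 + a o1 by rewrite addn_gt0 a_gt0.
rewrite -(prednK b0) /point_mult -prod_risingS prednK // big_add1 big_mkord.
apply: leq_prod => i _; rewrite /max_syz_deg big_tnth.
have := large_syzygy (ltn_ord i : i <= n); case/(tnthP (in_tuple _)) => j ->.
exact: (leq_bigmax_cond (F := fun j => tnth (in_tuple (syz_deg F i.+1)) j)).
Qed.

End FatBounds.

(** * The multiplicity bounds *)

Lemma extend_mult_decr n r (a : 'I_r.+1 -> nat) :
  (forall i j : 'I_r.+1, (i <= j)%N -> (a j <= a i)%N) ->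
  forall i j : 'I_n.+1, (i <= j)%N -> (extend_mult a j <= extend_mult a i)%N.
Proof.
move=> dec i j ij; rewrite /extend_mult.
case: insubP => [j' jr ej|] //=; case: insubP => [i' _ ei|] /=.
  by apply: dec; rewrite ei ej.
by rewrite (leq_ltn_trans ij jr).
Qed.

Lemma fat_multiplicity (k : fieldType) n (b : 'I_n.+1 -> nat) e : (0 < b ord0)%N ->
  multiplicity (mon_ideal (k := k) (fat_mon b)) e -> e = (\sum_l point_mult n (b l))%:R.
Proof.
move=> b0; apply: multiplicity_monomial (fat_mon_up (a := b)) _ _.
  rewrite (bigD1 ord0) //= addn_gt0; apply/orP; left.
  by case: (b ord0) b0 => // d _; rewrite /point_mult bin_gt0 leq_addr.
exact: (@count_standard _ b).
Qed.

Theorem proposition5p9 (k : fieldType) (char_k : [pchar k] =i pred0)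
    (n r : nat) (le_rn : (r <= n)%N)
    (P : 'M[k]_(r.+1, n.+1)) (general_P : row_free P)
    (a : 'I_r.+1 -> nat) (a_gt0 : forall i, (0 < a i)%N)
    (a_decr : forall i j : 'I_r.+1, (i <= j)%N -> (a j <= a i)%N)
    (c : nat) (codim_c : codimension (fat_points_ideal P a) c)
    (e : rat) (mult_e : multiplicity (fat_points_ideal P a) e)
    (F : min_graded_resolution (fat_points_ideal P a)) :
  (\prod_(1 <= i < c.+1) min_syz_deg F i)%N%:R / c`!%:R <= e /\
  e <= (\prod_(1 <= i < c.+1) max_syz_deg F i)%N%:R / c`!%:R.
Proof.
have [A uA PA] := row_free_completion le_rn general_P.
have cor := fat_points_linsub a uA PA.
pose b : 'I_n.+1 -> nat := extend_mult a.
have b0 : (0 < b ord0)%N.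
  have -> : ord0 = widen_ord (le_rn : (r < n.+1)%N) ord0 by apply: val_inj.
  by rewrite /b extend_mult_widen.
have eqc := fat_codim b0 (corresp_codim (linsubK uA) (linsubVK uA) cor codim_c).
have eqe := fat_multiplicity b0 (multiplicity_linsub uA cor mult_e).
have [F' eF] := resolution_linsub uA F cor.
have minE i : min_syz_deg F i = min_syz_deg F' i by rewrite /min_syz_deg eF.
have maxE i : max_syz_deg F i = max_syz_deg F' i by rewrite /max_syz_deg eF.
rewrite (eq_bigr _ (fun i _ => minE i)) (eq_bigr _ (fun i _ => maxE i)) {minE maxE}.
have f0 : (0 : rat) < c`!%:R by rewrite ltr0n fact_gt0.
rewrite ler_pdivrMr // ler_pdivlMr // eqe -natrM !ler_nat mulnC.
rewrite {}eqc {f0 eqe F eF mult_e codim_c cor A uA PA P general_P e c}.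
move: (extend_mult_decr (n := n) a_decr) b0; rewrite -/b.
move: @b F'; case: n le_rn => [|n] le_rn b F' b_decr b0.
  rewrite !big_geq // big_ord1 mul1n.
  by case: (b ord0) b0 => // d _; rewrite /point_mult bin0.
by split; [apply: prod_min_le|apply: prod_max_ge].
Qed.
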